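(* Let $\alpha>0$ and $\beta\in\mathbb{R}$ satisfy one of: $\beta<\alpha<1$; or $\beta<1<\alpha$; or $\beta<\alpha=1$. Then the $\beta$-Ces\`aro operator $C_\beta$ is a compact linear operator from $(\mathcal{B}_\alpha^0,\|\cdot\|_{\mathcal{B}_\alpha})$ to itself.
   Context: $\mathbb{D}=\{z\in\mathbb{C}:|z|<1\}$. For $\alpha>0$, the $\alpha$-Bloch space $\mathcal{B}_\alpha$ is the space of analytic functions $f$ on $\mathbb{D}$ with $\|f\|_{\mathcal{B}_\alpha}:=\sup_{z\in\mathbb{D}}(1-|z|^2)^\alpha|f'(z)|<\infty$. $\mathcal{B}_\alpha^0=\{f\in\mathcal{B}_\alpha: f(0)=0\}$, normed by $\|\cdot\|_{\mathcal{B}_\alpha}$. For $\beta\in\mathbb{R}$, the $\beta$-Ces\`aro operator is $C_\beta(f)(z)=\int_0^z \frac{f(w)}{w(1-w)^\beta}\,dw$ for analytic $f$ on $\mathbb{D}$ with $f(0)=0$, where $(1-w)^{\beta}$ is defined by the principal branch. *)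

(* Defs.v *)
From Stdlib Require Import Reals.
From Coquelicot Require Import Coquelicot.
Open Scope R_scope.

(* Principal argument Arg u in (-PI, PI], with Arg 0 = 0 (irrelevant). *)
Definition Carg (u : C) : R :=
  let x := fst u in let y := snd u in
  if Rlt_dec 0 x then atan (y / x)
  else if Rlt_dec x 0 then
         (if Rle_dec 0 y then atan (y / x) + PI else atan (y / x) - PI)
  else if Rlt_dec 0 y then PI / 2
  else if Rlt_dec y 0 then - (PI / 2) else 0.

Definition Clog (u : C) : C := (ln (Cmod u), Carg u).

Definition Cexp (u : C) : C := (exp (fst u) * cos (snd u), exp (fst u) * sin (snd u)).

Definition Cpow_pr (u : C) (b : R) : C := Cexp (RtoC b * Clog u)%C.

Definition in_disc (z : C) : Prop := Cmod z < 1.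

Definition analytic_on_disc (f : C -> C) : Prop :=
  forall z : C, in_disc z -> @ex_derive C_AbsRing C_NormedModule f z.

Definition bloch_bound (alpha : R) (f : C -> C) (M : R) : Prop :=
  forall (z d : C), in_disc z -> @is_derive C_AbsRing C_NormedModule f z d ->
    Rpower (1 - Cmod z ^ 2) alpha * Cmod d <= M.

Definition in_Bloch (alpha : R) (f : C -> C) : Prop :=
  analytic_on_disc f /\ exists M : R, bloch_bound alpha f M.

Definition in_Bloch0 (alpha : R) (f : C -> C) : Prop :=
  in_Bloch alpha f /\ f (RtoC 0) = RtoC 0.

(* beta-Cesaro operator:  C_beta f (z) = int_0^z f(w) / (w (1-w)^beta) dw,
   computed along the segment w = t z, t in [0,1] (dw = z dt). The integrand
   is analytic on the disc (f(0)=0), so the path does not matter. *)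
Definition cesaro (beta : R) (f : C -> C) (z : C) : C :=
  @RInt C_R_CompleteNormedModule
    (fun t : R => ((f (RtoC t * z) / ((RtoC t * z) * Cpow_pr (1 - RtoC t * z) beta)) * z)%C)
    0 1.

(* Main.v *)
(* Write [h(w) = f(w) / (w (1-w)^beta)], with the removable value [f'(0)] at the origin. [h] is
   continuous on the disc and holomorphic off 0, so Goursat's lemma for triangles with a vertex at 0
   makes the radial integral [cesaro beta f] a primitive of [h], and everything reduces to estimates
   for [h]. Choose exponents [gam > 0] and [b >= 0] with [alpha <= gam + 1], [beta <= b] and
   [gam + b < alpha]. Integrating [|f'| <= M (1-|z|)^-(gam+1)] gives
   [(1-|z|^2)^alpha |h(z)| <= C M (1-|z|)^(alpha-gam-b)]: this is boundedness, and also a uniformly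
   small contribution near the unit circle. Away from the circle and from 0, [h] is small as soon as
   [f] is, and near 0 the mean value property of [h] takes over. A sequence in the unit ball is
   equi-Lipschitz on compact discs, so pigeonholing on finite nets and a diagonal extraction give a
   subsequence whose functions [h] are Cauchy in the weighted sup norm; their primitives converge. *)
Require Import Defs.
From Stdlib Require Import Reals Lra Lia Classical ClassicalEpsilon List.
From Coquelicot Require Import Coquelicot.
Open Scope R_scope.

(** * Complex derivatives as real differentials *)

(** The obstacle is the origin: [h] is only known to be continuous there, and differentiability
    would need a theorem on removable singularities. Continuity is enough for the primitive, because
    a small triangle at 0 can be cut off and contributes arbitrarily little. The primitive in turn
    yields the mean value property without Cauchy's formula, which settles the neighbourhood of 0,
    where dividing by [w] spoils the information that [f] is small. No limit of the given sequence
    is ever formed: differences of its members become uniformly small on a smaller disc, so the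
    images are Cauchy, and only the images receive a limit. The strict inequality [gam + b < alpha]
    leaves a positive power of 1 - |z|; this power is what upgrades boundedness to compactness. *)

Notation is_Cderive := (@is_derive C_AbsRing C_NormedModule).
Notation Cfilterdiff := (@filterdiff R_AbsRing C_R_NormedModule C_R_NormedModule).

Lemma is_linear_Cmult_r (d : C) :
  @is_linear R_AbsRing C_R_NormedModule C_R_NormedModule (fun y => (y * d)%C).
Proof.
  constructor.
  - intros x y. change ((x + y) * d = x * d + y * d)%C. ring.
  - intros k [x1 x2]. destruct d as [d1 d2].
    unfold scal, mult; simpl; unfold prod_scal, scal, mult; simpl; unfold mult; simpl.
    unfold Cmult; simpl. f_equal; ring.
  - exists (Cmod d + 1). split. { pose proof (Cmod_ge_0 d). lra. }
    intros x. rewrite <- !Cmod_norm, Cmod_mult.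
    pose proof (Cmod_ge_0 d). pose proof (Cmod_ge_0 x). nra.
Qed.

Lemma locally_C_eps (z : C) (P : C -> Prop) :
  @locally C_UniformSpace z P <->
  exists e : R, 0 < e /\ forall w, Cmod (w - z) < e -> P w.
Proof.
  split.
  - intros [e He]. exists e. split; [apply cond_pos|]. intros w Hw. apply He.
    apply C_NormedModule_mixin_compat1. exact Hw.
  - intros (e & He & H).
    (* Balls of the product uniform structure are squares, and [Cmod] exceeds the sup norm by a
       factor of at most sqrt 2 < 2. *)
    assert (He2 : 0 < e / 2) by lra.
    exists (mkposreal _ He2). intros w Hw. apply H.
    apply C_NormedModule_mixin_compat2 in Hw. simpl in Hw.
    change (minus w z) with (w - z)%C in Hw.
    assert (sqrt 2 < 2).
    { rewrite <- (sqrt_Rsqr 2) at 2 by lra. apply sqrt_lt_1; unfold Rsqr; lra. }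
    pose proof (Cmod_ge_0 (w - z)). nra.
Qed.

Definition Cdomin (f : C -> C) (z d : C) :=
  forall eps, 0 < eps -> exists e, 0 < e /\ forall w, Cmod (w - z) < e ->
    Cmod (f w - f z - (w - z) * d) <= eps * Cmod (w - z).

Lemma is_Cderive_eps (f : C -> C) (z d : C) : is_Cderive f z d <-> Cdomin f z d.
Proof.
  split.
  - intros [_ H] eps He. specialize (H z (fun P HP => HP) (mkposreal _ He)).
    apply locally_C in H. apply locally_C_eps in H. exact H.
  - intros H. split. { apply is_linear_scal_l. }
    intros x Hx. apply (@is_filter_lim_locally_unique C_AbsRing (AbsRing_NormedModule C_AbsRing)) in Hx.
    subst x.
    intros eps. destruct (H eps (cond_pos eps)) as (e & He & HH).
    apply locally_C. apply locally_C_eps. exists e; split; auto.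
Qed.

(** Multiplication by [d] is also real-linear, so a complex derivative is a real differential of a
    special form. This gives access to chain rules and integrals along real paths. *)
Lemma is_Cderive_filterdiff (f : C -> C) (z d : C) :
  is_Cderive f z d <-> Cfilterdiff f (locally z) (fun y => (y * d)%C).
Proof.
  rewrite is_Cderive_eps. split.
  - intros H. split. { apply is_linear_Cmult_r. }
    intros x Hx.
    apply (@is_filter_lim_locally_unique R_AbsRing C_R_NormedModule) in Hx. subst x.
    intros eps. destruct (H eps (cond_pos eps)) as (e & He & HH).
    apply locally_C_eps. exists e; split; auto. intros w Hw.
    rewrite <- !Cmod_norm. exact (HH w Hw).
  - intros [_ H] eps He. specialize (H z (fun P HP => HP) (mkposreal _ He)).
    apply locally_C_eps in H. destruct H as (e & He' & H). exists e. split; auto.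
    intros w Hw. specialize (H w Hw). rewrite <- !Cmod_norm in H. exact H.
Qed.

Definition Ccont (f : C -> C) (z : C) :=
  forall eps, 0 < eps -> exists e, 0 < e /\ forall w, Cmod (w - z) < e -> Cmod (f w - f z) < eps.

Lemma Ccont_continuous (f : C -> C) (z : C) :
  Ccont f z <-> @continuous C_UniformSpace C_UniformSpace f z.
Proof.
  split.
  - intros H P HP. apply locally_C_eps in HP. destruct HP as (e & He & HP).
    apply locally_C_eps. destruct (H e He) as (e' & He' & H'). exists e'. split; auto.
  - intros H eps He.
    assert (HH := H (fun w => Cmod (w - f z) < eps)).
    apply locally_C_eps. apply HH. apply locally_C_eps. exists eps. auto.
Qed.

Lemma is_Cderive_Ccont (f : C -> C) (z d : C) : is_Cderive f z d -> Ccont f z.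
Proof.
  intros H. apply is_Cderive_filterdiff in H. apply Ccont_continuous.
  apply (@filterdiff_continuous R_AbsRing C_R_NormedModule C_R_NormedModule). eexists; exact H.
Qed.

Notation is_path_derive := (@is_derive R_AbsRing C_R_NormedModule).

Lemma is_path_derive_comp (f : C -> C) (g : R -> C) (t : R) (d v : C) :
  is_Cderive f (g t) d -> is_path_derive g t v ->
  is_path_derive (fun s => f (g s)) t (d * v)%C.
Proof.
  intros Hf Hg. apply is_Cderive_filterdiff in Hf.
  apply (@filterdiff_ext_lin R_AbsRing (AbsRing_NormedModule R_AbsRing) C_R_NormedModule (locally t) _
    _ (fun y => (@scal R_AbsRing C_R_NormedModule y v * d)%C)).
  - exact (filterdiff_comp' g f t _ _ Hg Hf).
  - intros y. destruct v, d.
    unfold scal, mult; simpl; unfold prod_scal, scal, mult; simpl; unfold mult; simpl.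
    unfold Cmult; simpl. f_equal; ring.
Qed.

Lemma is_path_derive_pair (g : R -> C) (t : R) (v : C) :
  is_path_derive g t v <->
  is_derive (fun s => fst (g s)) t (fst v) /\ is_derive (fun s => snd (g s)) t (snd v).
Proof.
  split.
  - intros H. split.
    + refine (@filterdiff_comp' R_AbsRing (AbsRing_NormedModule R_AbsRing) C_R_NormedModule R_NormedModule
        g (fun z => fst z) t _ (fun z => fst z) H _).
      apply filterdiff_linear, is_linear_fst.
    + refine (@filterdiff_comp' R_AbsRing (AbsRing_NormedModule R_AbsRing) C_R_NormedModule R_NormedModule
        g (fun z => snd z) t _ (fun z => snd z) H _).
      apply filterdiff_linear, is_linear_snd.
  - intros [H1 H2].
    apply (@filterdiff_ext R_AbsRing (AbsRing_NormedModule R_AbsRing) C_R_NormedModule (locally t) _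
      (fun s => (fst (g s), snd (g s)))).
    { intros s. symmetry. apply surjective_pairing. }
    apply (@filterdiff_ext_lin R_AbsRing (AbsRing_NormedModule R_AbsRing) C_R_NormedModule (locally t) _
      _ (fun y : R => (scal y (fst v), scal y (snd v)))).
    2:{ intros y. reflexivity. }
    refine (@filterdiff_comp'_2 R_AbsRing R_NormedModule R_NormedModule R_NormedModule C_R_NormedModule
      _ _ (fun x y : R => (x, y)) t _ _ (fun x y : R => (x, y)) H1 H2 _).
    apply (@filterdiff_ext R_AbsRing C_R_NormedModule C_R_NormedModule _ _ (fun p => p)). { intros p. apply surjective_pairing. }
    apply (@filterdiff_ext_lin R_AbsRing C_R_NormedModule C_R_NormedModule _ _ _ (fun p => p)).
    + apply filterdiff_id.
    + intros p. apply surjective_pairing.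
Qed.

(** The product rule, and the inner function of the chain rule, live in the module that the ring C
    forms over itself. Both notions of derivative unfold to the estimate [Cdomin]. *)
Lemma is_Cderive_AbsRing (f : C -> C) (z d : C) :
  is_Cderive f z d <-> @is_derive C_AbsRing (AbsRing_NormedModule C_AbsRing) f z d.
Proof.
  rewrite is_Cderive_eps. split.
  - intros H. split. { apply is_linear_scal_l. }
    intros x Hx. apply (@is_filter_lim_locally_unique C_AbsRing (AbsRing_NormedModule C_AbsRing)) in Hx.
    subst x.
    intros eps. destruct (H eps (cond_pos eps)) as (e & He & HH).
    apply locally_C. apply locally_C_eps. exists e; split; auto.
  - intros [_ H] eps He. specialize (H z (fun P HP => HP) (mkposreal _ He)).
    apply locally_C in H. apply locally_C_eps in H. exact H.
Qed.

Lemma is_Cderive_mult (f g : C -> C) (z df dg : C) :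
  is_Cderive f z df -> is_Cderive g z dg ->
  is_Cderive (fun w => f w * g w)%C z (df * g z + f z * dg)%C.
Proof.
  intros Hf%is_Cderive_AbsRing Hg%is_Cderive_AbsRing. apply is_Cderive_AbsRing.
  exact (is_derive_mult f g z df dg Hf Hg Cmult_comm).
Qed.

Lemma is_Cderive_comp (f g : C -> C) (z df dg : C) :
  is_Cderive f (g z) df -> is_Cderive g z dg ->
  is_Cderive (fun w => f (g w)) z (df * dg)%C.
Proof.
  intros Hf Hg%is_Cderive_AbsRing.
  rewrite Cmult_comm. exact (is_derive_comp f g z df dg Hf Hg).
Qed.

Lemma is_Cderive_inv (z : C) : z <> RtoC 0 -> is_Cderive Cinv z (- / (z * z))%C.
Proof.
  intros Hz. apply is_Cderive_eps. intros eps He.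
  assert (Hz' := proj1 (Cmod_gt_0 z) Hz).
  set (m := Cmod z) in *.
  assert (Hm3 : 0 < eps * m ^ 3 / 2) by (assert (0 < m ^ 3) by (apply pow_lt; auto); nra).
  (* The first bound keeps |w| >= m/2. The remainder is |w - z|^2 / (|w| m^2), and the second bound
     makes it at most eps |w - z|. *)
  exists (Rmin (m / 2) (eps * m ^ 3 / 2)). split. { apply Rmin_pos; lra. }
  intros w Hw.
  assert (H1 := Rlt_le_trans _ _ _ Hw (Rmin_l _ _)).
  assert (H2 := Rlt_le_trans _ _ _ Hw (Rmin_r _ _)).
  assert (Hwm : m / 2 <= Cmod w).
  { assert (Hx := Cmod_triangle w (- (w - z))%C). rewrite Cmod_opp in Hx.
    replace (w + - (w - z))%C with z in Hx by ring. unfold m in *. lra. }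
  assert (Hw0 : w <> RtoC 0). { apply Cmod_gt_0. lra. }
  replace (/ w - / z - (w - z) * - / (z * z))%C with ((w - z) * (w - z) * / (w * (z * z)))%C
    by (field; repeat split; auto).
  assert (Hne : (w * (z * z))%C <> RtoC 0) by (repeat apply Cmult_neq_0; auto).
  rewrite !Cmod_mult, Cmod_inv, !Cmod_mult by auto. fold m.
  assert (Hd := Cmod_ge_0 (w - z)). set (d := Cmod (w - z)) in *.
  replace (d * d * / (Cmod w * (m * m))) with ((d * / (Cmod w * (m * m))) * d)
    by (field; split; lra).
  apply Rmult_le_compat_r; auto.
  assert (Hp : 0 < Cmod w * (m * m)) by (repeat apply Rmult_lt_0_compat; lra).
  apply (Rmult_le_reg_r (Cmod w * (m * m))); auto.
  rewrite Rmult_assoc, Rinv_l, Rmult_1_r by lra.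
  apply Rle_trans with (eps * m ^ 3 / 2). lra.
  apply Rle_trans with (eps * (m / 2 * (m * m))). { right; field. }
  apply Rmult_le_compat_l. lra. nra.
Qed.

(** * Segment integrals *)

Ltac C_components := apply injective_projections; simpl.

(** Cauchy-Schwarz: the left side is the real part of conj(c) d. *)
Lemma Cdot_le (c d : C) : fst c * fst d + snd c * snd d <= Cmod c * Cmod d.
Proof.
  rewrite <- (Cmod_conj c), <- Cmod_mult.
  apply Rle_trans with (2 := re_le_Cmod _). apply Rle_trans with (2 := Rle_abs _).
  right. unfold Re, Cconj. simpl. ring.
Qed.

(* Compare the projection of [g] onto the direction of [g 1 - g 0] with [G]. *)
Lemma path_increment_bound (g dg : R -> C) (G dG : R -> R) :
  (forall t, 0 <= t <= 1 -> is_path_derive g t (dg t)) ->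
  (forall t, 0 <= t <= 1 -> is_derive G t (dG t)) ->
  (forall t, 0 <= t <= 1 -> Cmod (dg t) <= dG t) ->
  Cmod (g 1 - g 0) <= G 1 - G 0.
Proof.
  intros Hg HG Hb.
  set (c := (g 1 - g 0)%C).
  assert (HGinc : 0 <= G 1 - G 0).
  { destruct (MVT_cor2 G dG 0 1) as (x & Hx & Hx'). lra.
    intros; apply is_derive_Reals; auto.
    rewrite Hx. pose proof (Hb x ltac:(lra)). pose proof (Cmod_ge_0 (dg x)). nra. }
  destruct (MVT_cor2 (fun t => fst c * fst (g t) + snd c * snd (g t) - Cmod c * G t)
     (fun t => fst c * fst (dg t) + snd c * snd (dg t) - Cmod c * dG t) 0 1) as (x & Hx & Hx').
  lra.
  { intros t Ht. apply is_derive_Reals.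
    destruct (proj1 (is_path_derive_pair g t (dg t)) (Hg t Ht)) as [H1 H2].
    apply (is_derive_minus (V := R_NormedModule)).
    apply (is_derive_plus (V := R_NormedModule)).
    all: apply is_derive_scal; auto. }
  pose proof (Cdot_le c (dg x)) as Hcs.
  assert (Hc2 : Cmod c ^ 2 = fst c * fst c + snd c * snd c).
  { rewrite Cmod2_alt. unfold Re, Im. ring. }
  pose proof (Hb x ltac:(lra)). pose proof (Cmod_ge_0 c).
  assert (Cmod c * Cmod (dg x) <= Cmod c * dG x) by (apply Rmult_le_compat_l; auto).
  assert (fst c = fst (g 1) - fst (g 0)) by (unfold c; simpl; ring).
  assert (snd c = snd (g 1) - snd (g 0)) by (unfold c; simpl; ring).
  assert (Cmod c ^ 2 <= Cmod c * (G 1 - G 0)).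
  { rewrite Hc2.
    assert (fst c * fst c = fst c * fst (g 1) - fst c * fst (g 0)) by (rewrite H2 at 2; ring).
    assert (snd c * snd c = snd c * snd (g 1) - snd c * snd (g 0)) by (rewrite H3 at 2; ring).
    lra. }
  destruct (Rle_lt_or_eq_dec _ _ H0) as [Hp | Hz]; [| rewrite <- Hz; auto].
  apply (Rmult_le_reg_l (Cmod c)); auto. lra.
Qed.

Lemma is_path_derive_line (a v : C) (t : R) : is_path_derive (fun s => a + RtoC s * v)%C t v.
Proof.
  apply is_path_derive_pair. destruct a, v. simpl. split; auto_derive; auto; ring.
Qed.

Lemma Cmod_increment_le (f df : C -> C) (a b : C) (K : R) :
  (forall t, 0 <= t <= 1 -> let w := (a + RtoC t * (b - a))%C in
     is_Cderive f w (df w) /\ Cmod (df w) <= K) ->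
  Cmod (f b - f a) <= K * Cmod (b - a).
Proof.
  intros H.
  set (l := fun s : R => (a + RtoC s * (b - a))%C).
  replace (f b) with (f (l 1)) by (f_equal; unfold l; C_components; ring).
  replace (f a) with (f (l 0)) by (f_equal; unfold l; C_components; ring).
  replace (K * Cmod (b - a)) with ((fun t => t * (K * Cmod (b - a))) 1 - (fun t => t * (K * Cmod (b - a))) 0)
    by ring.
  apply (path_increment_bound (fun s => f (l s)) (fun s => df (l s) * (b - a))%C
    (fun t => t * (K * Cmod (b - a))) (fun _ => K * Cmod (b - a))).
  - intros t Ht. apply is_path_derive_comp. apply H; auto. apply is_path_derive_line.
  - intros t Ht. auto_derive; auto; ring.
  - intros t Ht. rewrite Cmod_mult. apply Rmult_le_compat_r. apply Cmod_ge_0. apply H; auto.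
Qed.

Definition segment (a b : C) (P : C -> Prop) :=
  forall t, 0 <= t <= 1 -> P (a + RtoC t * (b - a))%C.

Definition seg_integrand (h : C -> C) (a b : C) (t : R) : C :=
  (h (a + RtoC t * (b - a)) * (b - a))%C.

Definition seg_int (h : C -> C) (a b : C) : C :=
  @RInt C_R_CompleteNormedModule (seg_integrand h a b) 0 1.

Lemma Ccont_path (h : C -> C) (g : R -> C) (t : R) (v c : C) :
  Ccont h (g t) -> is_path_derive g t v ->
  @continuous R_UniformSpace C_UniformSpace (fun s => h (g s) * c)%C t.
Proof.
  intros Hh Hg.
  apply (@continuous_comp R_UniformSpace C_UniformSpace C_UniformSpace (fun s => h (g s)) (fun z => z * c)%C).
  - apply (@continuous_comp R_UniformSpace C_UniformSpace C_UniformSpace g h).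
    + apply (@filterdiff_continuous R_AbsRing (AbsRing_NormedModule R_AbsRing) C_R_NormedModule).
      eexists. exact Hg.
    + apply Ccont_continuous, Hh.
  - apply (@linear_cont R_AbsRing C_R_NormedModule C_R_NormedModule), is_linear_Cmult_r.
Qed.

Lemma ex_RInt_seg (h : C -> C) (a b : C) (x y : R) :
  segment a b (Ccont h) -> 0 <= x <= 1 -> 0 <= y <= 1 ->
  @ex_RInt C_R_NormedModule (seg_integrand h a b) x y.
Proof.
  intros H Hx Hy. apply (@ex_RInt_continuous C_R_CompleteNormedModule).
  intros t Ht. unfold seg_integrand.
  apply (Ccont_path h (fun s => a + RtoC s * (b - a))%C t (b - a)).
  - apply H. revert Ht. unfold Rmin, Rmax. destruct (Rle_dec x y); lra.
  - apply is_path_derive_line.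
Qed.

Lemma scal_C_R (s : R) (z : C) : @scal R_AbsRing C_R_NormedModule s z = (RtoC s * z)%C.
Proof.
  destruct z. unfold scal; simpl; unfold prod_scal, scal; simpl; unfold mult; simpl.
  unfold Cmult; simpl. f_equal; ring.
Qed.

Lemma seg_int_split (h : C -> C) (a b : C) (s : R) :
  segment a b (Ccont h) -> 0 <= s <= 1 ->
  let m := (a + RtoC s * (b - a))%C in
  seg_int h a b = (seg_int h a m + seg_int h m b)%C.
Proof.
  intros H Hs m. unfold seg_int at 1.
  rewrite <- (@RInt_Chasles C_R_CompleteNormedModule _ 0 s 1) by (apply ex_RInt_seg; auto; lra).
  change plus with Cplus. f_equal.
  - replace s with (s * 1 + 0) at 1 by ring. replace 0 with (s * 0 + 0) at 1 by ring.
    rewrite <- (@RInt_comp_lin C_R_CompleteNormedModule).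
    2:{ apply ex_RInt_seg; auto; lra. }
    apply (@RInt_ext C_R_CompleteNormedModule). intros t _.
    refine (eq_trans (scal_C_R _ _) _). unfold seg_integrand, m.
    rewrite (Cmult_comm _ (_ * _)%C), <- Cmult_assoc. f_equal.
    + f_equal. C_components; ring.
    + C_components; ring.
  - replace 1 with ((1 - s) * 1 + s) at 1 by ring. replace s with ((1 - s) * 0 + s) at 1 by ring.
    rewrite <- (@RInt_comp_lin C_R_CompleteNormedModule).
    2:{ apply ex_RInt_seg; auto; lra. }
    apply (@RInt_ext C_R_CompleteNormedModule). intros t _.
    refine (eq_trans (scal_C_R _ _) _). unfold seg_integrand, m.
    rewrite (Cmult_comm _ (_ * _)%C), <- Cmult_assoc. f_equal.
    + f_equal. C_components; ring.
    + C_components; ring.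
Qed.

Lemma seg_int_swap (h : C -> C) (a b : C) :
  segment a b (Ccont h) -> seg_int h b a = (- seg_int h a b)%C.
Proof.
  intros H. symmetry. unfold seg_int.
  change Copp with (@opp C_R_CompleteNormedModule).
  rewrite (@opp_RInt_swap C_R_CompleteNormedModule) by (apply ex_RInt_seg; auto; lra).
  replace 1 with ((-1) * 0 + 1) at 1 by ring. replace 0 with ((-1) * 1 + 1) at 2 by ring.
  rewrite <- (@RInt_comp_lin C_R_CompleteNormedModule).
  2:{ apply ex_RInt_seg; auto; lra. }
  apply (@RInt_ext C_R_CompleteNormedModule). intros t _.
  refine (eq_trans (scal_C_R _ _) _). unfold seg_integrand.
  rewrite (Cmult_comm _ (_ * _)%C), <- Cmult_assoc. f_equal.
  + f_equal. C_components; ring.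
  + C_components; ring.
Qed.

(** The fundamental theorem of calculus evaluates the integral of [dF] exactly, so only [h - dF] has
    to be estimated. It is used with [F] = 0 for the plain length bound, with a quadratic [F] in
    Goursat's argument, and with a linear [F] to differentiate the radial integral. *)
Lemma seg_int_approx (h F dF : C -> C) (a b : C) (K : R) :
  segment a b (Ccont h) ->
  segment a b (fun w => is_Cderive F w (dF w) /\ Ccont dF w /\ Cmod (h w - dF w) <= K) ->
  Cmod (seg_int h a b - (F b - F a)) <= K * Cmod (b - a).
Proof.
  intros H HF.
  set (l := fun s : R => (a + RtoC s * (b - a))%C).
  assert (I1 : @is_RInt C_R_NormedModule (seg_integrand h a b) 0 1 (seg_int h a b)).
  { apply (@RInt_correct C_R_CompleteNormedModule). apply ex_RInt_seg; auto; lra. }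
  assert (I2 : @is_RInt C_R_NormedModule (seg_integrand dF a b) 0 1 (F b - F a)%C).
  { replace (F b) with (F (l 1)) by (f_equal; unfold l; C_components; ring).
    replace (F a) with (F (l 0)) by (f_equal; unfold l; C_components; ring).
    apply (@is_RInt_derive C_R_CompleteNormedModule (fun s => F (l s))).
    - intros t Ht. rewrite Rmin_left, Rmax_right in Ht by lra.
      apply is_path_derive_comp. apply HF; auto. apply is_path_derive_line.
    - intros t Ht. rewrite Rmin_left, Rmax_right in Ht by lra.
      apply (Ccont_path dF l t (b - a)). apply HF; auto. apply is_path_derive_line. }
  pose proof (@is_RInt_minus C_R_NormedModule _ _ _ _ _ _ I1 I2) as I3.
  rewrite Cmod_norm.
  replace (K * Cmod (b - a)) with ((1 - 0) * (K * Cmod (b - a))) by ring.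
  refine (@norm_RInt_le_const C_R_NormedModule _ 0 1 _ _ Rle_0_1 _ I3).
  intros t Ht. rewrite <- Cmod_norm. unfold seg_integrand.
  change (@minus C_R_NormedModule) with Cminus.
  destruct (HF t Ht) as (_ & _ & HK).
  match goal with |- Cmod ?x <= _ => replace x with ((h (l t) - dF (l t)) * (b - a))%C
    by (unfold l; C_components; ring) end.
  rewrite Cmod_mult. apply Rmult_le_compat_r; auto using Cmod_ge_0.
Qed.

Lemma Cmod_seg_int_le (h : C -> C) (a b : C) (K : R) :
  segment a b (fun w => Ccont h w /\ Cmod (h w) <= K) ->
  Cmod (seg_int h a b) <= K * Cmod (b - a).
Proof.
  intros H.
  replace (seg_int h a b) with (seg_int h a b - (RtoC 0 - RtoC 0))%C by (C_components; ring).
  apply (seg_int_approx h (fun _ => RtoC 0) (fun _ => RtoC 0)).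
  - intros t Ht. apply H; auto.
  - intros t Ht. split; [|split].
    + apply is_Cderive_AbsRing. apply (@is_derive_const C_AbsRing (AbsRing_NormedModule C_AbsRing)).
    + intros e He. exists 1. split. lra. intros. replace (RtoC 0 - RtoC 0)%C with (RtoC 0) by ring.
      rewrite Cmod_0. auto.
    + replace (h (a + t * (b - a)) - RtoC 0)%C with (h (a + RtoC t * (b - a)))%C by (C_components; ring).
      apply H; auto.
Qed.

(** * Goursat's lemma *)

Lemma C_cauchy_limit (u : nat -> C) :
  (forall eps, 0 < eps -> exists N, forall n m, (N <= n)%nat -> (N <= m)%nat -> Cmod (u n - u m) <= eps) ->
  exists p, forall eps, 0 < eps -> exists N, forall n, (N <= n)%nat -> Cmod (u n - p) <= eps.
Proof.
  intros H.
  assert (Hc : forall pr : C -> R, (forall x y, pr (x - y)%C = pr x - pr y) ->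
     (forall x, Rabs (pr x) <= Cmod x) -> exists l, Un_cv (fun n => pr (u n)) l).
  { intros pr Hl Hb. destruct (Rcomplete.R_complete (fun n => pr (u n))) as [l Hl'].
    - intros e He. destruct (H (e / 2) ltac:(lra)) as [N HN]. exists N. intros n m Hn Hm.
      unfold R_dist. rewrite <- Hl. eapply Rle_lt_trans. apply Hb.
      specialize (HN n m Hn Hm). lra.
    - exists l; exact Hl'. }
  destruct (Hc fst) as [x Hx]. reflexivity. { intros z. apply (re_le_Cmod z). }
  destruct (Hc snd) as [y Hy]. reflexivity.
  { intros z. apply Rle_trans with (2 := Rmax_Cmod z). apply Rmax_r. }
  exists (x, y). intros e He.
  destruct (Hx (e / 2) ltac:(lra)) as [N1 H1]. destruct (Hy (e / 2) ltac:(lra)) as [N2 H2].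
  exists (max N1 N2). intros n Hn.
  specialize (H1 n ltac:(lia)). specialize (H2 n ltac:(lia)). unfold R_dist in *.
  replace (u n - (x, y))%C with (RtoC (fst (u n) - x) + Ci * RtoC (snd (u n) - y))%C
    by (C_components; ring).
  apply Rle_trans with (1 := Cmod_triangle _ _).
  rewrite Cmod_mult, Cmod_Ci, !Cmod_R. lra.
Qed.

Definition tri (h : C -> C) (a b c : C) : C := (seg_int h a b + seg_int h b c + seg_int h c a)%C.

Definition convex (U : C -> Prop) :=
  forall a b, U a -> U b -> segment a b U.

Lemma convex_mid (U : C -> Prop) (a b : C) :
  convex U -> U a -> U b -> U (a + RtoC (/ 2) * (b - a))%C.
Proof. intros HU Ha Hb. apply HU; auto. lra. Qed.

(** The sides of the medial triangle [q r p] are each traversed once in either direction and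
    cancel. *)
Lemma tri_split (h : C -> C) (U : C -> Prop) (a b c : C) :
  convex U -> (forall w, U w -> Ccont h w) -> U a -> U b -> U c ->
  let p := (a + RtoC (/ 2) * (b - a))%C in
  let q := (b + RtoC (/ 2) * (c - b))%C in
  let r := (c + RtoC (/ 2) * (a - c))%C in
  tri h a b c = (tri h a p r + tri h p b q + tri h r q c + tri h q r p)%C.
Proof.
  intros HU Hh Ha Hb Hc p q r.
  assert (Hp : U p) by (apply convex_mid; auto).
  assert (Hq : U q) by (apply convex_mid; auto).
  assert (Hr : U r) by (apply convex_mid; auto).
  assert (HS : forall x y, U x -> U y -> segment x y (Ccont h)).
  { intros x y Hx Hy t Ht. apply Hh, (HU x y); auto. }
  unfold tri.
  rewrite (seg_int_split h a b (/ 2)), (seg_int_split h b c (/ 2)), (seg_int_split h c a (/ 2))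
    by (auto; lra).
  fold p q r.
  rewrite (seg_int_swap h p r), (seg_int_swap h q r), (seg_int_swap h p q) by auto.
  ring.
Qed.

(* The triangle with vertices [a], [a + s u], [a + s v] for fixed [u], [v] and a signed scale [s]:
   all triangles of the iterated midpoint subdivision have this shape. *)
Definition stri (h : C -> C) (u v a : C) (s : R) : C :=
  tri h a (a + RtoC s * u) (a + RtoC s * v).

Definition stri_in (U : C -> Prop) (u v a : C) (s : R) :=
  U a /\ U (a + RtoC s * u)%C /\ U (a + RtoC s * v)%C.

(** One of the four subtriangles keeps at least a quarter of the integral, and a quarter is also the
    factor by which [s ^ 2] drops. The corner triangles have scale s/2; the central one, read from
    [q], is a point reflection and has scale -s/2, which is why scales are signed. *)
Lemma stri_step (h : C -> C) (U : C -> Prop) (u v a : C) (s eta : R) :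
  convex U -> (forall w, U w -> Ccont h w) ->
  stri_in U u v a s -> eta * s ^ 2 < Cmod (stri h u v a s) ->
  exists a' s', stri_in U u v a' s' /\ eta * s' ^ 2 < Cmod (stri h u v a' s') /\
    Rabs s' = Rabs s / 2 /\ Cmod (a' - a) <= Rabs s * (Cmod u + Cmod v).
Proof.
  intros HU Hh (Ha & Hb & Hc) Hlt.
  set (b := (a + RtoC s * u)%C) in *. set (c := (a + RtoC s * v)%C) in *.
  pose proof (tri_split h U a b c HU Hh Ha Hb Hc) as Hsplit. cbv zeta in Hsplit.
  set (p := (a + RtoC (/ 2) * (b - a))%C) in *.
  set (q := (b + RtoC (/ 2) * (c - b))%C) in *.
  set (r := (c + RtoC (/ 2) * (a - c))%C) in *.
  assert (Hp : U p) by (apply convex_mid; auto).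
  assert (Hq : U q) by (apply convex_mid; auto).
  assert (Hr : U r) by (apply convex_mid; auto).
  (* Coordinates [x], [y] in [0,1] for the displacement of the vertex give one distance bound for
     all four cases. *)
  assert (E : exists a' s', stri_in U u v a' s' /\ eta * s' ^ 2 < Cmod (stri h u v a' s') /\
     Rabs s' = Rabs s / 2 /\ exists x y, 0 <= x <= 1 /\ 0 <= y <= 1 /\
       (a' - a = RtoC s * (RtoC x * u + RtoC y * v))%C).
  { assert (Hs : forall a' s' b' c', (s' = s / 2 \/ s' = - s / 2) ->
      (a' + RtoC s' * u)%C = b' -> (a' + RtoC s' * v)%C = c' ->
      U a' -> U b' -> U c' ->
      (exists x y, 0 <= x <= 1 /\ 0 <= y <= 1 /\
        (a' - a = RtoC s * (RtoC x * u + RtoC y * v))%C) ->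
      eta * s ^ 2 / 4 < Cmod (tri h a' b' c') ->
      exists a' s', stri_in U u v a' s' /\ eta * s' ^ 2 < Cmod (stri h u v a' s') /\
       Rabs s' = Rabs s / 2 /\ exists x y, 0 <= x <= 1 /\ 0 <= y <= 1 /\
       (a' - a = RtoC s * (RtoC x * u + RtoC y * v))%C).
    { intros a' s' b' c' Hs Eb Ec Ha' Hb' Hc' Hxy HT. exists a', s'.
      unfold stri_in, stri. rewrite Eb, Ec. repeat split; auto.
      - replace (eta * s' ^ 2) with (eta * s ^ 2 / 4) by (destruct Hs as [-> | ->]; field). auto.
      - destruct Hs as [-> | ->]; unfold Rdiv; rewrite Rabs_mult, ?Rabs_Ropp, (Rabs_pos_eq (/ 2)); lra. }
    destruct (Rlt_dec (eta * s ^ 2 / 4) (Cmod (tri h a p r))) as [H1 | H1].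
    { apply (Hs a (s / 2) p r); auto.
      - unfold p, b. C_components; field.
      - unfold r, c. C_components; field.
      - exists 0, 0. repeat split; try lra. C_components; ring. }
    destruct (Rlt_dec (eta * s ^ 2 / 4) (Cmod (tri h p b q))) as [H2 | H2].
    { apply (Hs p (s / 2) b q); auto.
      - unfold p, b. C_components; field.
      - unfold q, p, b, c. C_components; field.
      - exists (/ 2), 0. repeat split; try lra. unfold p, b. C_components; field. }
    destruct (Rlt_dec (eta * s ^ 2 / 4) (Cmod (tri h r q c))) as [H3 | H3].
    { apply (Hs r (s / 2) q c); auto.
      - unfold q, r, b, c. C_components; field.
      - unfold r, c. C_components; field.
      - exists 0, (/ 2). repeat split; try lra. unfold r, c. C_components; field. }
    destruct (Rlt_dec (eta * s ^ 2 / 4) (Cmod (tri h q r p))) as [H4 | H4].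
    { apply (Hs q (- s / 2) r p); auto.
      - unfold q, r, b, c. C_components; field.
      - unfold q, p, b, c. C_components; field.
      - exists (/ 2), (/ 2). repeat split; try lra. unfold q, b, c. C_components; field. }
    exfalso. unfold stri in Hlt. fold b c in Hlt. rewrite Hsplit in Hlt.
    pose proof (Cmod_triangle (tri h a p r + tri h p b q + tri h r q c) (tri h q r p)).
    pose proof (Cmod_triangle (tri h a p r + tri h p b q) (tri h r q c)).
    pose proof (Cmod_triangle (tri h a p r) (tri h p b q)).
    lra. }
  destruct E as (a' & s' & H1 & H2 & H3 & x & y & Hx & Hy & E).
  exists a', s'. repeat split; auto; try apply H1.
  rewrite E, Cmod_mult, Cmod_R. apply Rmult_le_compat_l. apply Rabs_pos.
  apply Rle_trans with (1 := Cmod_triangle _ _). rewrite !Cmod_mult, !Cmod_R, !Rabs_pos_eq by lra.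
  pose proof (Cmod_ge_0 u). pose proof (Cmod_ge_0 v). nra.
Qed.

(** Near [p] the function is [lin] up to eps |w - p|, and [lin] has the quadratic primitive [F],
    whose increments cancel around the triangle. Each of the three sides then contributes at most
    eps times the distance 3 |s| L times the length |s| L. *)
Lemma stri_small (h : C -> C) (U : C -> Prop) (u v p d : C) (eps L : R) :
  convex U -> (forall w, U w -> Ccont h w) ->
  L = Cmod u + Cmod v -> Cdomin h p d -> 0 < eps ->
  exists e, 0 < e /\ forall a s, stri_in U u v a s -> Rabs s * L <= e ->
    Cmod (a - p) <= 2 * L * Rabs s ->
    Cmod (stri h u v a s) <= eps * (9 * L ^ 2) * s ^ 2.
Proof.
  intros HU Hh HL Hd Heps.
  destruct (Hd eps Heps) as (e & He & Hlin).
  (* Points of the triangle lie within 3 |s| L <= 3e/4 of [p], hence strictly inside the range of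
     [Hlin]. *)
  exists (e / 4). split. lra. intros a s (Ha & Hb & Hc) Hs Hap.
  assert (Lu : Cmod u <= L) by (pose proof (Cmod_ge_0 v); lra).
  assert (Lv : Cmod v <= L) by (pose proof (Cmod_ge_0 u); lra).
  set (lin := fun w => (h p + (w - p) * d)%C).
  set (F := fun w => (w * h p + RtoC (/ 2) * ((w - p) * (w - p)) * d)%C).
  assert (HF : forall w, is_Cderive F w (lin w)).
  { intros w. apply is_Cderive_eps. intros ep Hep.
    exists (ep / (Cmod d + 1)). pose proof (Cmod_ge_0 d).
    split. { apply Rdiv_lt_0_compat; lra. }
    intros w' Hw'. replace (F w' - F w - (w' - w) * lin w)%C with
      (RtoC (/ 2) * (w' - w) * d * (w' - w))%C by (unfold F, lin; C_components; field).
    rewrite !Cmod_mult, Cmod_R, Rabs_pos_eq by lra.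
    apply Rmult_le_compat_r. apply Cmod_ge_0.
    apply Rlt_le in Hw'. apply (Rmult_le_compat_r (Cmod d + 1)) in Hw'; [|lra].
    replace (ep / (Cmod d + 1) * (Cmod d + 1)) with ep in Hw' by (field; lra).
    pose proof (Cmod_ge_0 (w' - w)). nra. }
  assert (Hlc : forall w, Ccont lin w).
  { intros w ep Hep. exists (ep / (Cmod d + 1)). pose proof (Cmod_ge_0 d).
    split. { apply Rdiv_lt_0_compat; lra. }
    intros w' Hw'. replace (lin w' - lin w)%C with ((w' - w) * d)%C by (unfold lin; C_components; ring).
    rewrite Cmod_mult. apply (Rmult_lt_compat_r (Cmod d + 1)) in Hw'; [|lra].
    replace (ep / (Cmod d + 1) * (Cmod d + 1)) with ep in Hw' by (field; lra).
    pose proof (Cmod_ge_0 (w' - w)). nra. }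
  assert (Hside : forall x y, U x -> U y ->
     (forall t, 0 <= t <= 1 -> Cmod (x + RtoC t * (y - x) - a) <= Rabs s * L) ->
     Cmod (y - x) <= Rabs s * L ->
     Cmod (seg_int h x y - (F y - F x)) <= eps * (3 * (Rabs s * L)) * (Rabs s * L)).
  { intros x y Hx Hy Hxy Hl.
    assert (Hp : 0 <= Rabs s * L).
    { apply Rmult_le_pos. apply Rabs_pos. pose proof (Cmod_ge_0 u). lra. }
    apply Rle_trans with (eps * (3 * (Rabs s * L)) * Cmod (y - x)).
    2:{ apply Rmult_le_compat_l; auto. apply Rmult_le_pos; lra. }
    apply (seg_int_approx h F lin).
    { intros t Ht. apply Hh, (HU x y); auto. }
    intros t Ht. split; [auto | split; [auto |]].
    set (w := (x + RtoC t * (y - x))%C).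
    assert (Hw : Cmod (w - p) <= 3 * (Rabs s * L)).
    { replace (w - p)%C with ((w - a) + (a - p))%C by (C_components; ring).
      apply Rle_trans with (1 := Cmod_triangle _ _). specialize (Hxy t Ht). fold w in Hxy. lra. }
    replace (h w - lin w)%C with (h w - h p - (w - p) * d)%C by (unfold lin; C_components; ring).
    apply Rle_trans with (eps * Cmod (w - p)). { apply Hlin. lra. }
    apply Rmult_le_compat_l; lra. }
  unfold stri, tri.
  set (b := (a + RtoC s * u)%C) in *. set (c := (a + RtoC s * v)%C) in *.
  replace (seg_int h a b + seg_int h b c + seg_int h c a)%C with
    ((seg_int h a b - (F b - F a)) + (seg_int h b c - (F c - F b)) + (seg_int h c a - (F a - F c)))%C
    by (C_components; ring).
  assert (Hu : forall x y, 0 <= x -> 0 <= y -> x + y <= 1 ->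
     Cmod (RtoC s * (RtoC x * u + RtoC y * v)) <= Rabs s * L).
  { intros x y Hx Hy Hxy. rewrite Cmod_mult, Cmod_R. apply Rmult_le_compat_l. apply Rabs_pos.
    apply Rle_trans with (1 := Cmod_triangle _ _).
    rewrite !Cmod_mult, !Cmod_R, !Rabs_pos_eq by lra.
    pose proof (Cmod_ge_0 u). pose proof (Cmod_ge_0 v). nra. }
  replace (eps * (9 * L ^ 2) * s ^ 2) with (3 * (eps * (3 * (Rabs s * L)) * (Rabs s * L))).
  2:{ rewrite <- (pow2_abs s). ring. }
  assert (H1 := Hside a b Ha Hb). assert (H2 := Hside b c Hb Hc). assert (H3 := Hside c a Hc Ha).
  assert (HL0 : 0 <= Rabs s * L).
  { apply Rmult_le_pos. apply Rabs_pos. pose proof (Cmod_ge_0 u). lra. }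
  pose proof (Cmod_triangle ((seg_int h a b - (F b - F a)) + (seg_int h b c - (F c - F b)))
     (seg_int h c a - (F a - F c))).
  pose proof (Cmod_triangle (seg_int h a b - (F b - F a)) (seg_int h b c - (F c - F b))).
  assert (Cmod (seg_int h a b - (F b - F a)) <= eps * (3 * (Rabs s * L)) * (Rabs s * L)).
  { apply H1.
    - intros t Ht. replace (a + RtoC t * (b - a) - a)%C with (RtoC s * (RtoC t * u + RtoC 0 * v))%C
        by (unfold b; C_components; ring). apply Hu; lra.
    - replace (b - a)%C with (RtoC s * (RtoC 1 * u + RtoC 0 * v))%C
        by (unfold b; C_components; ring). apply Hu; lra. }
  assert (Cmod (seg_int h b c - (F c - F b)) <= eps * (3 * (Rabs s * L)) * (Rabs s * L)).
  { apply H2.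
    - intros t Ht. replace (b + RtoC t * (c - b) - a)%C with (RtoC s * (RtoC (1 - t) * u + RtoC t * v))%C
        by (unfold b, c; C_components; ring). apply Hu; lra.
    - replace (c - b)%C with (RtoC s * (v - u))%C by (unfold b, c; C_components; ring).
      rewrite Cmod_mult, Cmod_R. apply Rmult_le_compat_l. apply Rabs_pos.
      apply Rle_trans with (1 := Cmod_triangle _ _). rewrite Cmod_opp. lra. }
  assert (Cmod (seg_int h c a - (F a - F c)) <= eps * (3 * (Rabs s * L)) * (Rabs s * L)).
  { apply H3.
    - intros t Ht. replace (c + RtoC t * (a - c) - a)%C with (RtoC s * (RtoC 0 * u + RtoC (1 - t) * v))%C
        by (unfold c; C_components; ring). apply Hu; lra.
    - rewrite <- Cmod_opp. replace (- (a - c))%C with (RtoC s * (RtoC 0 * u + RtoC 1 * v))%C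
        by (unfold c; C_components; ring). apply Hu; lra. }
  lra.
Qed.

Lemma INR_le_pow2 (n : nat) : INR n <= 2 ^ n.
Proof.
  induction n as [|n IH]; [simpl; lra|]. rewrite S_INR. simpl.
  pose proof (pow_R1_Rle 2 n ltac:(lra)). lra.
Qed.

Lemma half_pow_small (L e : R) : 0 <= L -> 0 < e -> exists n, (/ 2) ^ n * L <= e.
Proof.
  intros HL He. destruct (INR_archimed e L He) as [n Hn]. exists n.
  rewrite pow_inv. pose proof (INR_le_pow2 n).
  assert (0 < 2 ^ n) by (apply pow_lt; lra).
  apply (Rmult_le_reg_l (2 ^ n)); auto. rewrite <- Rmult_assoc, Rinv_r, Rmult_1_l by lra.
  nra.
Qed.

(** Positive distance from every outside point: the form that forces the limit of the nested
    triangles into [U]. *)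
Definition Cclosed (U : C -> Prop) :=
  forall p, ~ U p -> exists e, 0 < e /\ forall w, U w -> e <= Cmod (w - p).

(** Otherwise subdivision keeps the ratio of the integral to [s ^ 2] above a fixed [eta], while
    differentiability at the limit of the vertices makes this ratio arbitrarily small. *)
Lemma goursat (h : C -> C) (U : C -> Prop) (a b c : C) :
  convex U -> Cclosed U -> (forall w, U w -> exists d, is_Cderive h w d) ->
  U a -> U b -> U c -> tri h a b c = RtoC 0.
Proof.
  intros HU Hcl Hd Ha Hb Hc.
  assert (Hh : forall w, U w -> Ccont h w).
  { intros w Hw. destruct (Hd w Hw) as [d Hd']. eapply is_Cderive_Ccont; eauto. }
  apply NNPP. intros Hne. apply Cmod_gt_0 in Hne.
  set (u := (b - a)%C). set (v := (c - a)%C). set (L := Cmod u + Cmod v).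
  set (eta := Cmod (tri h a b c) / 2). assert (Heta : 0 < eta) by (unfold eta; lra).
  assert (HL : 0 <= L) by (unfold L; pose proof (Cmod_ge_0 u); pose proof (Cmod_ge_0 v); lra).
  set (Q := fun x : C * R => stri_in U u v (fst x) (snd x) /\
              eta * snd x ^ 2 < Cmod (stri h u v (fst x) (snd x))).
  (* Carrying the invariant [Q] in a sigma type lets the choice of a subtriangle be iterated by
     plain recursion. *)
  assert (step : forall x : {x | Q x}, {y : {y | Q y} |
     Rabs (snd (proj1_sig y)) = Rabs (snd (proj1_sig x)) / 2 /\
     Cmod (fst (proj1_sig y) - fst (proj1_sig x)) <= Rabs (snd (proj1_sig x)) * L}).
  { intros [[a0 s0] [H1 H2]]. apply constructive_indefinite_description.
    destruct (stri_step h U u v a0 s0 eta HU Hh H1 H2) as (a' & s' & H3 & H4 & H5 & H6).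
    exists (exist Q (a', s') (conj H3 H4)). simpl. auto. }
  assert (Q0 : Q (a, 1)).
  { assert (E1 : (a + RtoC 1 * u)%C = b) by (unfold u; C_components; ring).
    assert (E2 : (a + RtoC 1 * v)%C = c) by (unfold v; C_components; ring).
    unfold Q, stri_in, stri; cbn [fst snd]. rewrite E1, E2. repeat split; auto.
    unfold eta. lra. }
  set (st := nat_rect (fun _ => {x | Q x}) (exist Q _ Q0) (fun _ x => proj1_sig (step x))).
  set (A := fun n => fst (proj1_sig (st n))). set (S := fun n => snd (proj1_sig (st n))).
  assert (HQ : forall n, Q (A n, S n)).
  { intros n. unfold A, S. rewrite <- surjective_pairing. apply proj2_sig. }
  assert (HS : forall n, Rabs (S n) = (/ 2) ^ n).
  { induction n as [|n IH]. { unfold S; simpl. apply Rabs_R1. }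
    destruct (proj2_sig (step (st n))) as [H1 _]. change (Rabs (S (Datatypes.S n)) = Rabs (S n) / 2) in H1.
    rewrite H1, IH. simpl. field. }
  assert (HA : forall n, Cmod (A (Datatypes.S n) - A n) <= (/ 2) ^ n * L).
  { intros n. destruct (proj2_sig (step (st n))) as [_ H1].
    change (Cmod (A (Datatypes.S n) - A n) <= Rabs (S n) * L) in H1. rewrite HS in H1. auto. }
  (* Telescoped geometric sum; keeping the exact difference of powers makes the induction on [k] go
     through. *)
  assert (HAA : forall n k, Cmod (A (n + k)%nat - A n) <= (2 * L) * ((/ 2) ^ n - (/ 2) ^ (n + k))).
  { intros n k. induction k as [|k IH].
    - rewrite Nat.add_0_r. replace (A n - A n)%C with (RtoC 0) by ring. rewrite Cmod_0. lra.
    - rewrite Nat.add_succ_r.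
      replace (A (Datatypes.S (n + k)) - A n)%C with
        ((A (Datatypes.S (n + k)) - A (n + k)%nat) + (A (n + k)%nat - A n))%C by ring.
      apply Rle_trans with (1 := Cmod_triangle _ _). specialize (HA (n + k)%nat). simpl. lra. }
  assert (Hpos : forall n, 0 < (/ 2) ^ n) by (intros; apply pow_lt; lra).
  assert (HAle : forall n m, (n <= m)%nat -> Cmod (A m - A n) <= 2 * L * (/ 2) ^ n).
  { intros n m Hnm. replace m with (n + (m - n))%nat by lia.
    apply Rle_trans with (1 := HAA _ _). pose proof (Hpos (n + (m - n))%nat). nra. }
  destruct (C_cauchy_limit A) as [p Hp].
  { intros e He. destruct (half_pow_small (4 * L) e ltac:(lra) He) as [N HN]. exists N.
    intros n m Hn Hm. replace (A n - A m)%C with ((A n - A N) - (A m - A N))%C by ring.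
    apply Rle_trans with (1 := Cmod_triangle _ _). rewrite Cmod_opp.
    pose proof (HAle N n Hn). pose proof (HAle N m Hm). lra. }
  assert (HAp : forall n, Cmod (A n - p) <= 2 * L * (/ 2) ^ n).
  { intros n. apply Rle_plus_epsilon. intros e He. destruct (Hp e He) as [N HN].
    replace (A n - p)%C with (- (A (max n N) - A n) + (A (max n N) - p))%C by ring.
    apply Rle_trans with (1 := Cmod_triangle _ _). rewrite Cmod_opp.
    specialize (HN (max n N) ltac:(lia)). pose proof (HAle n (max n N) ltac:(lia)). lra. }
  assert (HUp : U p).
  { apply NNPP. intros HnU. destruct (Hcl p HnU) as (e & He & HUe).
    destruct (Hp (e / 2) ltac:(lra)) as [N HN]. specialize (HN N ltac:(lia)).
    specialize (HUe (A N)). destruct (HQ N) as [[H1 _] _]. specialize (HUe H1). lra. }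
  destruct (Hd p HUp) as [d Hd']. apply is_Cderive_eps in Hd'.
  (* Dividing [eta] by this makes the bound of [stri_small] at most [eta * s ^ 2]; the summand 1
     also covers [L] = 0. *)
  assert (Hden : 0 < 9 * L ^ 2 + 1) by nra.
  destruct (stri_small h U u v p d (eta / (9 * L ^ 2 + 1)) L HU Hh eq_refl Hd') as (e & He & Hsm).
  { apply Rdiv_lt_0_compat; auto. }
  destruct (half_pow_small L e HL He) as [n Hn].
  destruct (HQ n) as [H1 H2]. cbn [fst snd] in *.
  specialize (Hsm (A n) (S n) H1). rewrite HS in Hsm. specialize (Hsm Hn (HAp n)).
  assert (Hs2 : 0 < S n ^ 2) by (rewrite <- pow2_abs, HS; apply pow_lt; auto).
  assert (eta / (9 * L ^ 2 + 1) * (9 * L ^ 2) <= eta).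
  { apply Rle_trans with (eta / (9 * L ^ 2 + 1) * (9 * L ^ 2 + 1)).
    - apply Rmult_le_compat_l. apply Rlt_le, Rdiv_lt_0_compat; auto. lra.
    - right. field. lra. }
  nra.
Qed.

(** * Primitives on the disc of functions holomorphic off the origin *)

Lemma Cmod_segment_le (a b : C) (r t : R) :
  Cmod a <= r -> Cmod b <= r -> 0 <= t <= 1 -> Cmod (a + RtoC t * (b - a)) <= r.
Proof.
  intros Ha Hb Ht. replace (a + RtoC t * (b - a))%C with (RtoC (1 - t) * a + RtoC t * b)%C
    by (C_components; ring).
  apply Rle_trans with (1 := Cmod_triangle _ _).
  rewrite !Cmod_mult, !Cmod_R, !Rabs_pos_eq by lra. nra.
Qed.

Lemma in_disc_0 : in_disc (RtoC 0).
Proof. unfold in_disc. rewrite Cmod_0. lra. Qed.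

Lemma segment_disc (a b : C) : in_disc a -> in_disc b -> segment a b in_disc.
Proof.
  unfold in_disc. intros Ha Hb t Ht.
  apply Rle_lt_trans with (Rmax (Cmod a) (Cmod b)).
  - apply Cmod_segment_le; auto. apply Rmax_l. apply Rmax_r.
  - apply Rmax_lub_lt; auto.
Qed.

Lemma seg_int_point (h : C -> C) (a : C) : Ccont h a -> seg_int h a a = RtoC 0.
Proof.
  intros H. apply Cmod_eq_0. apply Rle_antisym; [|apply Cmod_ge_0].
  replace 0 with (Cmod (h a) * Cmod (a - a))
    by (replace (a - a)%C with (RtoC 0) by ring; rewrite Cmod_0; ring).
  apply Cmod_seg_int_le. intros t Ht.
  replace (a + RtoC t * (a - a))%C with a by ring. split; auto. lra.
Qed.

(** The part of a closed disc in a half-plane orthogonal to [a]. For [c] > 0 and [r] < 1 it is a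
    closed convex subset of the unit disc missing 0, so Goursat's lemma applies on it. *)
Definition cap (a : C) (c r : R) (w : C) : Prop :=
  c <= fst w * fst a + snd w * snd a /\ Cmod w <= r.

Lemma cap_convex (a : C) (c r : R) : convex (cap a c r).
Proof.
  intros x y [Hx Hx'] [Hy Hy'] t Ht. split.
  - apply Rle_trans with ((1 - t) * (fst x * fst a + snd x * snd a) + t * (fst y * fst a + snd y * snd a)).
    + apply Rle_trans with ((1 - t) * c + t * c). lra.
      apply Rplus_le_compat; apply Rmult_le_compat_l; lra.
    + right. simpl. ring.
  - apply Cmod_segment_le; auto.
Qed.

Lemma cap_closed (a : C) (c r : R) : Cclosed (cap a c r).
Proof.
  intros p Hp.
  destruct (Rle_dec (Cmod p) r) as [Hr | Hr].
  - assert (Hc : fst p * fst a + snd p * snd a < c).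
    { apply Rnot_le_lt. intros H. apply Hp. split; auto. }
    pose proof (Cmod_ge_0 a).
    (* The distance to the half-plane, with |a| + 1 for |a| so that [a] = 0 needs no separate
       case. *)
    exists ((c - (fst p * fst a + snd p * snd a)) / (Cmod a + 1)). split.
    { apply Rdiv_lt_0_compat; lra. }
    intros w [Hw _]. pose proof (Cdot_le (w - p) a). simpl in H0.
    apply (Rmult_le_reg_r (Cmod a + 1)). lra.
    unfold Rdiv. rewrite Rmult_assoc, Rinv_l by lra. pose proof (Cmod_ge_0 (w - p)). lra.
  - exists (Cmod p - r). split. lra. intros w [_ Hw].
    pose proof (Cmod_triangle w (- (w - p))). rewrite Cmod_opp in H.
    replace (w + - (w - p))%C with p in H by ring. lra.
Qed.

Section Primitive.

Context (h : C -> C)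
  (hc : forall w, in_disc w -> Ccont h w)
  (hd : forall w, in_disc w -> w <> RtoC 0 -> exists d, is_Cderive h w d).

Lemma segment_Ccont (a b : C) : in_disc a -> in_disc b -> segment a b (Ccont h).
Proof. intros Ha Hb t Ht. apply hc. apply segment_disc; auto. Qed.

(** Cut off the triangle 0, [p], [q], a copy scaled by [s]. The remaining quadrilateral splits into
    two triangles inside a cap missing 0, where Goursat applies, and the small triangle contributes
    at most 3 K s with [s] arbitrary. The hypothesis on |b - a| puts [b] in the open half-plane of
    [a], so such a cap exists. *)
Lemma tri_vertex_0 (a b : C) :
  in_disc a -> in_disc b -> Cmod (b - a) < Cmod a -> tri h (RtoC 0) a b = RtoC 0.
Proof.
  intros Ha Hb Hab. pose proof in_disc_0 as H0.
  (* The smaller of the inner products of [a] and [b] with [a]. After scaling, [p] and [q] still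
     have inner product at least [s * m], the level used for the cap. *)
  set (m := Rmin (fst a * fst a + snd a * snd a) (fst b * fst a + snd b * snd a)).
  assert (Hm : 0 < m).
  { pose proof (Cmod2_alt a) as Ea. unfold Re, Im in Ea.
    pose proof (Cmod_ge_0 (b - a)).
    apply Rmin_glb_lt. nra.
    pose proof (Cdot_le (a - b)%C a) as Hdot. simpl in Hdot.
    rewrite <- Cmod_opp in Hab. replace (- (b - a))%C with (a - b)%C in Hab by ring.
    pose proof (Cmod_ge_0 (a - b)).
    assert (0 < Cmod a * (Cmod a - Cmod (a - b))) by (apply Rmult_lt_0_compat; lra).
    nra. }
  destruct (hc _ H0 1 Rlt_0_1) as (e & He & Hbd).
  set (K := Cmod (h (RtoC 0)) + 1).
  assert (HK : forall w, Cmod w < e -> Cmod (h w) <= K).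
  { intros w Hw. replace w with (w - RtoC 0)%C in Hw by ring. specialize (Hbd w Hw).
    pose proof (Cmod_triangle (h w - h (RtoC 0)) (h (RtoC 0))).
    replace (h w - h (RtoC 0) + h (RtoC 0))%C with (h w) in H by ring. unfold K. lra. }
  assert (HK0 : 0 < K) by (unfold K; pose proof (Cmod_ge_0 (h (RtoC 0))); lra).
  unfold in_disc in Ha, Hb.
  assert (Hs : forall s, 0 < s < 1 -> s < e -> Cmod (tri h (RtoC 0) a b) <= K * s * 3).
  { intros s Hs Hse. set (p := (RtoC 0 + RtoC s * (a - RtoC 0))%C).
    set (q := (RtoC 0 + RtoC s * (b - RtoC 0))%C).
    assert (Ep : Cmod p = s * Cmod a).
    { unfold p. replace (RtoC 0 + RtoC s * (a - RtoC 0))%C with (RtoC s * a)%C by ring.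
      rewrite Cmod_mult, Cmod_R, Rabs_pos_eq; lra. }
    assert (Eq : Cmod q = s * Cmod b).
    { unfold q. replace (RtoC 0 + RtoC s * (b - RtoC 0))%C with (RtoC s * b)%C by ring.
      rewrite Cmod_mult, Cmod_R, Rabs_pos_eq; lra. }
    assert (Epq : Cmod (q - p) = s * Cmod (b - a)).
    { unfold p, q. replace (RtoC 0 + RtoC s * (b - RtoC 0) - (RtoC 0 + RtoC s * (a - RtoC 0)))%C
        with (RtoC s * (b - a))%C by ring.
      rewrite Cmod_mult, Cmod_R, Rabs_pos_eq; lra. }
    pose proof (Cmod_ge_0 a). pose proof (Cmod_ge_0 b).
    set (r := Rmax (Cmod a) (Cmod b)).
    assert (Hr : r < 1) by (apply Rmax_lub_lt; auto).
    assert (Har : Cmod a <= r) by apply Rmax_l. assert (Hbr : Cmod b <= r) by apply Rmax_r.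
    set (U := cap a (s * m) r).
    assert (Ma : m <= fst a * fst a + snd a * snd a) by apply Rmin_l.
    assert (Mb : m <= fst b * fst a + snd b * snd a) by apply Rmin_r.
    assert (Ua : U a). { split; auto. nra. }
    assert (Ub : U b). { split; auto. nra. }
    assert (Up : U p). { split. unfold p; simpl. nra. rewrite Ep. nra. }
    assert (Uq : U q). { split. unfold q; simpl. nra. rewrite Eq. nra. }
    assert (HUd : forall w, U w -> in_disc w).
    { intros w [_ Hw]. unfold in_disc. lra. }
    assert (HUder : forall w, U w -> exists d, is_Cderive h w d).
    { intros w Hw. apply hd; auto. intros ->. destruct Hw as [Hw _]. simpl in Hw. nra. }
    pose proof (goursat h U p a b (cap_convex _ _ _) (cap_closed _ _ _) HUder Up Ua Ub) as T1.
    pose proof (goursat h U p b q (cap_convex _ _ _) (cap_closed _ _ _) HUder Up Ub Uq) as T2.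
    assert (E : tri h (RtoC 0) a b = (tri h (RtoC 0) p q + (tri h p a b + tri h p b q))%C).
    { unfold tri.
      rewrite (seg_int_swap h (RtoC 0) b) by (apply segment_Ccont; auto).
      rewrite (seg_int_split h (RtoC 0) a s), (seg_int_split h (RtoC 0) b s)
        by (try apply segment_Ccont; auto; lra).
      fold p q.
      rewrite (seg_int_swap h p b), (seg_int_swap h p q), (seg_int_swap h q b),
         (seg_int_swap h (RtoC 0) q) by (apply segment_Ccont; auto).
      ring. }
    rewrite E, T1, T2. replace (tri h (RtoC 0) p q + (RtoC 0 + RtoC 0))%C with (tri h (RtoC 0) p q) by ring.
    assert (Hseg : forall x y, Cmod x <= s -> Cmod y <= s -> Cmod (y - x) <= s ->
        Cmod (seg_int h x y) <= K * s).
    { intros x y Hx Hy Hxy. apply Rle_trans with (K * Cmod (y - x)).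
      - apply Cmod_seg_int_le. intros t Ht. pose proof (Cmod_segment_le x y s t Hx Hy Ht). split.
        + apply hc. unfold in_disc. lra.
        + apply HK. lra.
      - apply Rmult_le_compat_l; lra. }
    unfold tri.
    pose proof (Cmod_triangle (seg_int h (RtoC 0) p + seg_int h p q) (seg_int h q (RtoC 0))).
    pose proof (Cmod_triangle (seg_int h (RtoC 0) p) (seg_int h p q)).
    assert (Z : Cmod (RtoC 0) <= s) by (rewrite Cmod_0; lra).
    assert (Zp : Cmod p <= s) by (rewrite Ep; nra).
    assert (Zq : Cmod q <= s) by (rewrite Eq; nra).
    pose proof (Hseg (RtoC 0) p Z Zp) as S1. pose proof (Hseg p q Zp Zq) as S2.
    pose proof (Hseg q (RtoC 0) Zq Z) as S3.
    replace (p - RtoC 0)%C with p in S1 by ring.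
    replace (RtoC 0 - q)%C with (- q)%C in S3 by ring. rewrite Cmod_opp in S3.
    assert (Zpq : Cmod (q - p) <= s) by (rewrite Epq; nra).
    specialize (S1 Zp). specialize (S2 Zpq). specialize (S3 Zq). lra. }
  apply Cmod_eq_0, Rle_antisym; [|apply Cmod_ge_0].
  apply Rle_plus_epsilon. intros eps Heps.
  set (s := Rmin (Rmin (1 / 2) (e / 2)) (eps / (3 * K))).
  assert (Hep : 0 < eps / (3 * K)) by (apply Rdiv_lt_0_compat; lra).
  assert (Hs0 : 0 < s) by (repeat apply Rmin_pos; lra).
  assert (s <= 1 / 2) by (eapply Rle_trans; [apply Rmin_l | apply Rmin_l]).
  assert (s <= e / 2) by (eapply Rle_trans; [apply Rmin_l | apply Rmin_r]).
  assert (Hs3 : s <= eps / (3 * K)) by apply Rmin_r.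
  apply Rle_trans with (1 := Hs s ltac:(lra) ltac:(lra)).
  apply (Rmult_le_compat_l (3 * K)) in Hs3; [|lra].
  replace (3 * K * (eps / (3 * K))) with eps in Hs3 by (field; lra). lra.
Qed.

(** By [tri_vertex_0] the increment of the radial integral from [z] to a nearby [w] is the integral
    over the segment from [z] to [w], where [h] is nearly the constant [h z]. At [z] = 0 the
    increment is such an integral already. *)
Lemma disc_primitive (z : C) : in_disc z -> is_Cderive (seg_int h (RtoC 0)) z (h z).
Proof.
  intros Hz. apply is_Cderive_eps. intros eps Heps.
  destruct (hc z Hz eps Heps) as (e & He & Hbd).
  assert (Happ : forall w, in_disc w -> Cmod (w - z) < e ->
     Cmod (seg_int h z w - (w - z) * h z) <= eps * Cmod (w - z)).
  { intros w Hw Hwe.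
    replace (seg_int h z w - (w - z) * h z)%C with (seg_int h z w - (w * h z - z * h z))%C by ring.
    apply (seg_int_approx h (fun x => x * h z)%C (fun _ => h z)).
    { apply segment_Ccont; auto. }
    intros t Ht. split; [|split].
    - apply is_Cderive_eps. intros ep Hep. exists 1. split. lra. intros x _.
      match goal with |- Cmod ?x <= _ => replace x with (RtoC 0) by ring end.
      rewrite Cmod_0. apply Rmult_le_pos. lra. apply Cmod_ge_0.
    - intros ep Hep. exists 1. split. lra. intros. replace (h z - h z)%C with (RtoC 0) by ring.
      rewrite Cmod_0. auto.
    - apply Rlt_le, Hbd. replace (z + RtoC t * (w - z) - z)%C with (RtoC t * (w - z))%C by ring.
      rewrite Cmod_mult, Cmod_R, Rabs_pos_eq by lra. pose proof (Cmod_ge_0 (w - z)). nra. }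
  unfold in_disc in Hz.
  destruct (Req_dec (Cmod z) 0) as [Hz0 | Hz0].
  - exists (Rmin e 1). split. { apply Rmin_pos; lra. }
    intros w Hw. apply Cmod_eq_0 in Hz0. subst z.
    rewrite (seg_int_point h (RtoC 0)) by (apply hc, in_disc_0).
    replace (seg_int h (RtoC 0) w - RtoC 0 - (w - RtoC 0) * h (RtoC 0))%C with
      (seg_int h (RtoC 0) w - (w - RtoC 0) * h (RtoC 0))%C by ring.
    apply Happ.
    + unfold in_disc. replace w with (w - RtoC 0)%C by ring. apply Rlt_le_trans with (1 := Hw), Rmin_r.
    + apply Rlt_le_trans with (1 := Hw), Rmin_l.
  - pose proof (Cmod_ge_0 z).
    (* The last entry supplies the condition |w - z| < |z| of [tri_vertex_0], the middle one keeps
       [w] in the disc. *)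
    exists (Rmin e (Rmin (1 - Cmod z) (Cmod z))). split. { repeat apply Rmin_pos; lra. }
    intros w Hw.
    assert (H1 := Rlt_le_trans _ _ _ Hw (Rmin_l _ _)).
    assert (H2 := Rlt_le_trans _ _ _ (Rlt_le_trans _ _ _ Hw (Rmin_r _ _)) (Rmin_l _ _)).
    assert (H3 := Rlt_le_trans _ _ _ (Rlt_le_trans _ _ _ Hw (Rmin_r _ _)) (Rmin_r _ _)).
    assert (Hwd : in_disc w).
    { unfold in_disc. replace w with (z + (w - z))%C by ring.
      apply Rle_lt_trans with (1 := Cmod_triangle _ _). lra. }
    pose proof (tri_vertex_0 z w Hz Hwd H3) as T. unfold tri in T.
    rewrite (seg_int_swap h (RtoC 0) w) in T by (apply segment_Ccont; auto using in_disc_0).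
    replace (seg_int h (RtoC 0) w - seg_int h (RtoC 0) z)%C with (seg_int h z w).
    + apply Happ; auto.
    + transitivity (seg_int h z w -
        (seg_int h (RtoC 0) z + seg_int h z w + - seg_int h (RtoC 0) w))%C; [rewrite T|]; ring.
Qed.

End Primitive.

(** * The mean value property on circles *)

Lemma Cmod_cos_sin (t : R) : Cmod (cos t, sin t) = 1.
Proof.
  unfold Cmod; simpl. replace (cos t * (cos t * 1) + sin t * (sin t * 1)) with 1. apply sqrt_1.
  pose proof (sin2_cos2 t). unfold Rsqr in *. lra.
Qed.

(** The radius is signed, because the circle means are also differentiated at radius 0. *)
Definition circle (z : C) (r t : R) : C := (z + RtoC r * (cos t, sin t))%C.

Lemma circle_disc (z : C) (r t : R) : Cmod z + Rabs r < 1 -> in_disc (circle z r t).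
Proof.
  intros H. unfold in_disc, circle. apply Rle_lt_trans with (1 := Cmod_triangle _ _).
  rewrite Cmod_mult, Cmod_R.
  rewrite Cmod_cos_sin. lra.
Qed.

Lemma circle_derive_r (z : C) (r t : R) :
  is_path_derive (fun s => circle z s t) r (cos t, sin t).
Proof. apply is_path_derive_pair. simpl. split; auto_derive; auto; ring. Qed.

Lemma circle_derive_t (z : C) (r t : R) :
  is_path_derive (circle z r) t (RtoC r * ((- sin t)%R, cos t))%C.
Proof. apply is_path_derive_pair. simpl. split; auto_derive; auto; ring. Qed.

Lemma circle_lipschitz (z : C) (r s t u : R) :
  Cmod (circle z r t - circle z s u) <= Rabs (r - s) + Rabs s * (2 * Rabs (t - u)).
Proof.
  assert (Hc : forall x y, Rabs (cos x - cos y) <= Rabs (x - y)).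
  { intros x y. rewrite <- (Rmult_1_l (Rabs (x - y))).
    apply (bounded_variation cos (fun t => - sin t)). intros w _. split.
    - auto_derive; auto; ring.
    - rewrite Rabs_Ropp. apply Rabs_le. apply SIN_bound. }
  assert (Hs : forall x y, Rabs (sin x - sin y) <= Rabs (x - y)).
  { intros x y. rewrite <- (Rmult_1_l (Rabs (x - y))).
    apply (bounded_variation sin cos). intros w _. split.
    - auto_derive; auto; ring.
    - apply Rabs_le. apply COS_bound. }
  replace (circle z r t - circle z s u)%C with
    (RtoC (r - s) * (cos t, sin t) + RtoC s * (RtoC (cos t - cos u) + Ci * RtoC (sin t - sin u)))%C
    by (unfold circle; C_components; ring).
  apply Rle_trans with (1 := Cmod_triangle _ _). rewrite !Cmod_mult, !Cmod_R.
  rewrite Cmod_cos_sin, Rmult_1_r. apply Rplus_le_compat_l. apply Rmult_le_compat_l. apply Rabs_pos.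
  apply Rle_trans with (1 := Cmod_triangle _ _). rewrite Cmod_mult, Cmod_Ci, !Cmod_R.
  pose proof (Hc t u). pose proof (Hs t u). lra.
Qed.

(* With [A r], [B r] the integrals of [Re (c H e^(-it))], [Re (c h)] over the circle of radius [r]:
   on it [d/dr (H e^(-it)) = h] gives [A' = B], and [d/dt (H e^(-it)) = i (r h - H e^(-it))] gives
   [A = r B]. Hence [A r / r] is constant, and so is [B]. *)
Section MeanValue.

Context (h H : C -> C) (z c : C)
  (hc : forall w, in_disc w -> Ccont h w)
  (HH : forall w, in_disc w -> is_Cderive H w (h w)).

Let f (r t : R) : R := fst (H (circle z r t) * c * (cos t, (- sin t)%R))%C.
Let f2 (r t : R) : R := snd (H (circle z r t) * c * (cos t, (- sin t)%R))%C.
Let k (r t : R) : R := fst (h (circle z r t) * c)%C.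
Let A (r : R) : R := RInt (f r) 0 (2 * PI).
Let B (r : R) : R := RInt (k r) 0 (2 * PI).

Lemma twisted_derive_r (r t : R) : Cmod z + Rabs r < 1 -> is_derive (fun s => f s t) r (k r t).
Proof.
  intros Hr.
  pose proof (is_path_derive_comp H (fun s => circle z s t) r _ _ (HH _ (circle_disc z r t Hr)) (circle_derive_r z r t)) as D.
  apply is_path_derive_pair in D. destruct D as [D1 D2]. unfold f, k; simpl in *.
  set (h0 := h (circle z r t)) in *.
  evar_last.
  - apply @is_derive_minus.
    + apply @is_derive_mult; [| apply @is_derive_const | exact Rmult_comm].
      apply @is_derive_minus; (apply @is_derive_mult; [| apply @is_derive_const | exact Rmult_comm]); eassumption.
    + apply @is_derive_mult; [| apply @is_derive_const | exact Rmult_comm].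
      apply @is_derive_plus; (apply @is_derive_mult; [| apply @is_derive_const | exact Rmult_comm]); eassumption.
  - unfold minus, plus, opp, mult, zero; simpl. unfold mult; simpl.
    pose proof (sin2_cos2 t) as E. unfold Rsqr in E.
    transitivity ((fst h0 * fst c - snd h0 * snd c) * (sin t * sin t + cos t * cos t)).
    + ring.
    + rewrite E. ring.
Qed.

Lemma twisted_im_derive_t (r t : R) : Cmod z + Rabs r < 1 ->
  is_derive (f2 r) t (r * k r t - f r t).
Proof.
  intros Hr.
  pose proof (is_path_derive_comp H (circle z r) t _ _ (HH _ (circle_disc z r t Hr)) (circle_derive_t z r t)) as D.
  apply is_path_derive_pair in D. destruct D as [D1 D2]. unfold f, f2, k; simpl in *.
  set (h0 := h (circle z r t)) in *.
  assert (Dc : is_derive cos t (- sin t)) by (auto_derive; auto; ring).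
  assert (Ds : is_derive (fun t => - sin t) t (- cos t)) by (auto_derive; auto; ring).
  evar_last.
  - apply @is_derive_plus.
    + apply @is_derive_mult; [| apply Ds | exact Rmult_comm].
      apply @is_derive_minus; (apply @is_derive_mult; [| apply @is_derive_const | exact Rmult_comm]); eassumption.
    + apply @is_derive_mult; [| apply Dc | exact Rmult_comm].
      apply @is_derive_plus; (apply @is_derive_mult; [| apply @is_derive_const | exact Rmult_comm]); eassumption.
  - unfold minus, plus, opp, mult, zero; simpl. unfold mult; simpl.
    pose proof (sin2_cos2 t) as E. unfold Rsqr in E.
    transitivity (r * (fst h0 * fst c - snd h0 * snd c) * (sin t * sin t + cos t * cos t) -
       ((fst (H (circle z r t)) * fst c - snd (H (circle z r t)) * snd c) * cos t -
        (fst (H (circle z r t)) * snd c + snd (H (circle z r t)) * fst c) * - sin t)).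
    + ring.
    + rewrite E. ring.
Qed.

Lemma twisted_continuous (r t : R) : Cmod z + Rabs r < 1 -> continuous (f r) t.
Proof.
  intros Hr.
  pose proof (is_path_derive_comp H (circle z r) t _ _ (HH _ (circle_disc z r t Hr)) (circle_derive_t z r t)) as D.
  apply is_path_derive_pair in D. destruct D as [D1 D2]. unfold f; simpl in *.
  assert (Dc : is_derive cos t (- sin t)) by (auto_derive; auto; ring).
  assert (Ds : is_derive (fun t => - sin t) t (- cos t)) by (auto_derive; auto; ring).
  apply (@ex_derive_continuous R_AbsRing R_NormedModule). eexists.
  apply @is_derive_minus.
  - apply @is_derive_mult; [| apply Dc | exact Rmult_comm].
    apply @is_derive_minus; (apply @is_derive_mult; [| apply @is_derive_const | exact Rmult_comm]); eassumption.
  - apply @is_derive_mult; [| apply Ds | exact Rmult_comm].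
    apply @is_derive_plus; (apply @is_derive_mult; [| apply @is_derive_const | exact Rmult_comm]); eassumption.
Qed.

Lemma circle_value_continuous (r t : R) : Cmod z + Rabs r < 1 -> continuous (k r) t.
Proof.
  intros Hr. unfold k.
  apply (@continuous_comp R_UniformSpace C_UniformSpace R_UniformSpace
    (fun t => h (circle z r t) * c)%C (fun w : C => fst w)).
  - apply (Ccont_path h (circle z r) t _ c (hc _ (circle_disc z r t Hr)) (circle_derive_t z r t)).
  - apply (@linear_cont R_AbsRing C_R_NormedModule R_NormedModule), is_linear_fst.
Qed.

Lemma circle_value_continuity_2d (r t : R) : Cmod z + Rabs r < 1 -> continuity_2d_pt k r t.
Proof.
  intros Hr eps.
  pose proof (Cmod_ge_0 c). pose proof (Rabs_pos r).
  destruct (hc _ (circle_disc z r t Hr) (eps / (Cmod c + 1))) as (e & He & Hbd).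
  { apply Rdiv_lt_0_compat. apply cond_pos. lra. }
  assert (Hd : 0 < Rmin (e / 6) 1) by (apply Rmin_pos; lra).
  exists (mkposreal _ Hd). simpl. intros u v Hu Hv.
  assert (Hu' := Rlt_le_trans _ _ _ Hu (Rmin_l _ _)).
  assert (Hv' := Rlt_le_trans _ _ _ Hv (Rmin_l _ _)).
  pose proof (circle_lipschitz z u r v t).
  pose proof (Cmod_ge_0 z). pose proof (Rabs_pos (v - t)).
  assert (Rabs r * (2 * Rabs (v - t)) <= 1 * (2 * Rabs (v - t))) by (apply Rmult_le_compat_r; lra).
  specialize (Hbd (circle z u v) ltac:(lra)).
  unfold k.
  replace (fst (h (circle z u v) * c)%C - fst (h (circle z r t) * c)%C) with
    (fst ((h (circle z u v) - h (circle z r t)) * c)%C) by (simpl; ring).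
  apply Rle_lt_trans with (1 := re_le_Cmod _). rewrite Cmod_mult.
  apply (Rmult_lt_compat_r (Cmod c + 1)) in Hbd; [|lra].
  replace (eps / (Cmod c + 1) * (Cmod c + 1)) with (eps : R) in Hbd by (field; lra).
  pose proof (Cmod_ge_0 (h (circle z u v) - h (circle z r t))). nra.
Qed.

(** Differentiation under the integral sign, for which the radial derivative [k] must be jointly
    continuous in radius and angle. *)
Lemma twisted_mean_derive (r : R) : Cmod z + Rabs r < 1 -> is_derive A r (B r).
Proof.
  intros Hr.
  assert (Hloc : locally r (fun s => Cmod z + Rabs s < 1)).
  { assert (Hp : 0 < 1 - Cmod z - Rabs r) by lra. exists (mkposreal _ Hp). intros s Hs.
    change (Rabs (s - r) < 1 - Cmod z - Rabs r) in Hs.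
    pose proof (Rabs_triang_inv s r). lra. }
  unfold A, B.
  rewrite (RInt_ext (k r) (fun t => Derive (fun u => f u t) r)).
  2:{ intros t _. symmetry. apply is_derive_unique, twisted_derive_r; auto. }
  apply is_derive_RInt_param.
  - generalize Hloc. apply filter_imp. intros s Hs t _. eexists. apply twisted_derive_r; auto.
  - intros t _. apply (continuity_2d_pt_ext_loc k).
    + destruct Hloc as [e He]. exists e. intros u v Hu _. symmetry.
      apply is_derive_unique, twisted_derive_r. apply He. exact Hu.
    + apply circle_value_continuity_2d; auto.
  - generalize Hloc. apply filter_imp. intros s Hs.
    apply (@ex_RInt_continuous R_CompleteNormedModule). intros t _.
    apply twisted_continuous; auto.
Qed.

Lemma circle_value_integral (r : R) : Cmod z + Rabs r < 1 -> is_RInt (k r) 0 (2 * PI) (B r).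
Proof.
  intros Hr. apply (@RInt_correct R_CompleteNormedModule).
  apply (@ex_RInt_continuous R_CompleteNormedModule). intros t _. apply circle_value_continuous; auto.
Qed.

Lemma twisted_mean_eq (r : R) : Cmod z + Rabs r < 1 -> A r = r * B r.
Proof.
  intros Hr.
  assert (I1 : is_RInt (fun t => r * k r t - f r t) 0 (2 * PI) (f2 r (2 * PI) - f2 r 0)).
  { apply (@is_RInt_derive R_CompleteNormedModule).
    - intros t _. apply twisted_im_derive_t; auto.
    - intros t _. apply (@continuous_minus R_UniformSpace R_AbsRing R_NormedModule).
      + apply (@continuous_scal_r R_UniformSpace R_AbsRing R_NormedModule). apply circle_value_continuous; auto.
      + apply twisted_continuous; auto. }
  assert (I2 : is_RInt (fun t => r * k r t - f r t) 0 (2 * PI) (r * B r - A r)).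
  { apply (@is_RInt_minus R_NormedModule).
    - apply (@is_RInt_scal R_NormedModule). apply circle_value_integral; auto.
    - apply (@RInt_correct R_CompleteNormedModule).
      apply (@ex_RInt_continuous R_CompleteNormedModule). intros t _. apply twisted_continuous; auto. }
  apply (@is_RInt_unique R_CompleteNormedModule) in I1.
  apply (@is_RInt_unique R_CompleteNormedModule) in I2.
  rewrite I1 in I2.
  assert (f2 r (2 * PI) = f2 r 0).
  { unfold f2, circle. rewrite cos_2PI, sin_2PI, cos_0, sin_0. reflexivity. }
  lra.
Qed.

Lemma circle_mean_const (r : R) : 0 < r -> Cmod z + r < 1 -> B r = B 0.
Proof.
  intros Hr Hz.
  assert (Hin : forall s, 0 <= s <= r -> Cmod z + Rabs s < 1) by (intros; rewrite Rabs_pos_eq; lra).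
  assert (HB : forall s, 0 < s < r -> B s = B r).
  { intros s Hs.
    assert (E : A r / r = A s / s).
    { destruct (MVT_cor2 (fun x => A x / x) (fun x => (B x * x - A x) / x ^ 2) s r) as (x & Hx & Hx'). lra.
      - intros x Hx. apply is_derive_Reals.
        pose proof (twisted_mean_derive x (Hin x ltac:(lra))) as D.
        pose proof (is_derive_div A (fun x => x) x (B x) 1 D (is_derive_id x) ltac:(lra)) as D'.
        rewrite Rmult_1_r in D'. exact D'.
      - rewrite (twisted_mean_eq x) in Hx by (apply Hin; lra).
        replace ((B x * x - x * B x) / x ^ 2) with 0 in Hx by (field; lra). lra. }
    rewrite (twisted_mean_eq r), (twisted_mean_eq s) in E by (apply Hin; lra).
    replace (r * B r / r) with (B r) in E by (field; lra).
    replace (s * B s / s) with (B s) in E by (field; lra). auto. }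
  apply cond_eq. intros e He.
  (* Since [A 0] = 0, the difference quotient of [A] at 0 is A s / s = [B s] = [B r], and its limit
     is [B 0]. *)
  pose proof (twisted_mean_derive 0 (Hin 0 ltac:(lra))) as D. apply is_derive_Reals in D.
  destruct (D e He) as [d Hd].
  pose proof (cond_pos d) as Hdp.
  set (s := Rmin (d / 2) (r / 2)).
  assert (Hs : 0 < s) by (apply Rmin_pos; lra).
  assert (s <= d / 2) by apply Rmin_l. assert (s <= r / 2) by apply Rmin_r.
  specialize (Hd s ltac:(lra)). rewrite Rabs_pos_eq in Hd by lra. specialize (Hd ltac:(lra)).
  rewrite Rplus_0_l, (twisted_mean_eq s), (twisted_mean_eq 0), (HB s) in Hd by (try apply Hin; lra).
  replace ((s * B r - 0 * B 0) / s) with (B r) in Hd by (field; lra). auto.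
Qed.

End MeanValue.

(** Taking [c] = conj(h z) turns the central value into 2 PI |h z|^2, while the mean on the circle
    is at most 2 PI eta |h z|. Real parts therefore suffice to bound the modulus. *)
Lemma circle_max (h H : C -> C) (z : C) (r eta : R) :
  (forall w, in_disc w -> Ccont h w) ->
  (forall w, in_disc w -> is_Cderive H w (h w)) ->
  0 < r -> Cmod z + r < 1 ->
  (forall w, Cmod (w - z) = r -> Cmod (h w) <= eta) ->
  Cmod (h z) <= eta.
Proof.
  intros hc HH Hr Hz Hb.
  pose proof (circle_mean_const h H z (Cconj (h z)) hc HH r Hr Hz) as E.
  assert (Hr0 : Cmod z + Rabs 0 < 1) by (rewrite Rabs_R0; lra).
  assert (Hrr : Cmod z + Rabs r < 1) by (rewrite Rabs_pos_eq; lra).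
  pose proof PI_RGT_0 as HPI. pose proof (Cmod_ge_0 (h z)) as Hz0.
  assert (E0 : RInt (fun t => fst (h (circle z 0 t) * Cconj (h z))%C) 0 (2 * PI) = 2 * PI * Cmod (h z) ^ 2).
  { rewrite (RInt_ext _ (fun _ => Cmod (h z) ^ 2)).
    - rewrite RInt_const. unfold scal; simpl; unfold mult; simpl. ring.
    - intros t _. unfold circle. replace (z + RtoC 0 * (cos t, sin t))%C with z by ring.
      rewrite Cmod2_alt. unfold Re, Im. simpl. ring. }
  cbv beta in E. rewrite E0 in E.
  pose proof (circle_value_integral h z (Cconj (h z)) hc r Hrr) as I.
  assert (HI : norm (RInt (fun t => fst (h (circle z r t) * Cconj (h z))%C) 0 (2 * PI))
     <= (2 * PI - 0) * (eta * Cmod (h z))).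
  { apply (@norm_RInt_le_const R_NormedModule _ 0 (2 * PI) _ _ ltac:(lra)) with (2 := I).
    intros t _. apply Rle_trans with (1 := re_le_Cmod _). rewrite Cmod_mult, Cmod_conj.
    apply Rmult_le_compat_r; auto. apply Hb. unfold circle.
    replace (z + RtoC r * (cos t, sin t) - z)%C with (RtoC r * (cos t, sin t))%C by ring.
    rewrite Cmod_mult, Cmod_R, Cmod_cos_sin, Rabs_pos_eq; lra. }
  rewrite E in HI. change (norm (2 * PI * Cmod (h z) ^ 2)) with (Rabs (2 * PI * Cmod (h z) ^ 2)) in HI.
  apply Rle_trans with (1 := Rle_abs _) in HI.
  destruct (Rle_lt_or_eq_dec _ _ Hz0) as [Hp | Hp].
  - apply (Rmult_le_reg_l (2 * PI * Cmod (h z))). { apply Rmult_lt_0_compat; lra. }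
    lra.
  (* If [h z] = 0, it remains to see that [eta] is nonnegative, which the point z + r of the circle
     shows. *)
  - rewrite <- Hp. apply Rle_trans with (Cmod (h (z + RtoC r)%C)). apply Cmod_ge_0.
    apply Hb. replace (z + RtoC r - z)%C with (RtoC r) by ring. rewrite Cmod_R. apply Rabs_pos_eq; lra.
Qed.

(** * The principal power and the primitive of the Cesaro integrand *)

(** Continuity of the x-partials, together with y-partials at the point alone, gives real
    differentiability. The two equations make the differential multiplication by a complex
    number. *)
Lemma cauchy_riemann (u v ux vx : R -> R -> R) (x y uy vy : R) :
  locally ((x, y) : C) (fun p => is_derive (fun s => u s (snd p)) (fst p) (ux (fst p) (snd p))) ->
  locally ((x, y) : C) (fun p => is_derive (fun s => v s (snd p)) (fst p) (vx (fst p) (snd p))) ->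
  is_derive (fun s => u x s) y uy -> is_derive (fun s => v x s) y vy ->
  continuous (fun p : R * R => ux (fst p) (snd p)) (x, y) ->
  continuous (fun p : R * R => vx (fst p) (snd p)) (x, y) ->
  uy = - vx x y -> vy = ux x y ->
  is_Cderive (fun w => (u (fst w) (snd w), v (fst w) (snd w))) (x, y) (ux x y, vx x y).
Proof.
  intros U1 V1 U2 V2 Cu Cv E1 E2. apply is_Cderive_filterdiff.
  pose proof (is_derive_filterdiff u x y ux uy U1 U2 Cu) as DU.
  pose proof (is_derive_filterdiff v x y vx vy V1 V2 Cv) as DV.
  apply (@filterdiff_ext_lin R_AbsRing C_R_NormedModule C_R_NormedModule (locally ((x, y) : C)) _ _
    (fun p => (plus (scal (fst p) (ux x y)) (scal (snd p) uy),
               plus (scal (fst p) (vx x y)) (scal (snd p) vy)))).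
  - refine (@filterdiff_comp'_2 R_AbsRing C_R_NormedModule R_NormedModule R_NormedModule C_R_NormedModule
      _ _ (fun x y : R => (x, y)) (x, y) _ _ (fun x y : R => (x, y)) DU DV _).
    apply (@filterdiff_ext R_AbsRing C_R_NormedModule C_R_NormedModule _ _ (fun p => p)).
    { intros p. apply surjective_pairing. }
    apply (@filterdiff_ext_lin R_AbsRing C_R_NormedModule C_R_NormedModule _ _ _ (fun p => p)).
    + apply filterdiff_id.
    + intros p. apply surjective_pairing.
  - intros [p q]. rewrite E1, E2. unfold plus, scal; simpl. unfold mult, Cmult; simpl. f_equal; ring.
Qed.

Lemma Cexp_derive (w : C) : is_Cderive Cexp w (Cexp w).
Proof.
  destruct w as [x y].
  apply (cauchy_riemann (fun x y => exp x * cos y) (fun x y => exp x * sin y)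
    (fun x y => exp x * cos y) (fun x y => exp x * sin y) x y (- (exp x * sin y)) (exp x * cos y)).
  - apply filter_forall. intros p. auto_derive; auto; ring.
  - apply filter_forall. intros p. auto_derive; auto; ring.
  - auto_derive; auto; ring.
  - auto_derive; auto; ring.
  - apply (continuous_mult (fun p : R * R => exp (fst p)) (fun p => cos (snd p))).
    + apply (continuous_comp fst exp). apply continuous_fst. apply continuous_exp.
    + apply (continuous_comp snd cos). apply continuous_snd. apply continuous_cos.
  - apply (continuous_mult (fun p : R * R => exp (fst p)) (fun p => sin (snd p))).
    + apply (continuous_comp fst exp). apply continuous_fst. apply continuous_exp.
    + apply (continuous_comp snd sin). apply continuous_snd. apply continuous_sin.
  - ring.
  - ring.
Qed.

Lemma locally_re_pos (x y : R) : 0 < x -> locally ((x, y) : C) (fun p => 0 < fst p).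
Proof.
  intros Hx. apply locally_C_eps. exists x. split; auto. intros w Hw.
  pose proof (re_le_Cmod (w - (x, y))) as H. unfold Re in H. simpl in H.
  pose proof (Rabs_def2 _ _ (Rle_lt_trans _ _ _ H Hw)). lra.
Qed.

Lemma is_derive_ln_norm (a b : R) : 0 < a * a + b * b ->
  is_derive (fun s => ln (sqrt (s ^ 2 + b ^ 2))) a (a / (a * a + b * b)).
Proof.
  intros H. replace (a * a + b * b) with (a ^ 2 + b ^ 2) in * by ring.
  pose proof (sqrt_lt_R0 _ H) as Hq. pose proof (sqrt_sqrt _ (Rlt_le _ _ H)) as Hqq.
  auto_derive.
  - split; [|split; auto]; replace (a * (a * 1) + b * (b * 1)) with (a ^ 2 + b ^ 2) by ring; auto.
  - replace (a * (a * 1) + b * (b * 1)) with (a ^ 2 + b ^ 2) by ring.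
    rewrite <- Hqq at 3. field. lra.
Qed.

(** On the right half-plane the argument is just atan(y/x). This covers all that is needed, since 1
    - w lies there for [w] in the disc. *)
Lemma Clog_derive (w : C) : 0 < fst w -> exists d, is_Cderive Clog w d.
Proof.
  destruct w as [x y]. simpl. intros Hx.
  pose proof (locally_re_pos x y Hx) as Hloc.
  assert (Hn : forall a b, 0 < a -> 0 < a * a + b * b) by (intros; nra).
  assert (Hc : forall g : R * R -> R, continuous g (x, y) ->
    continuous (fun p : R * R => g p / (fst p * fst p + snd p * snd p)) (x, y)).
  { intros g Hg. apply (continuous_mult g (fun p => / (fst p * fst p + snd p * snd p))); auto.
    apply (continuous_comp (fun p : R * R => fst p * fst p + snd p * snd p) Rinv).
    - apply (continuous_plus (fun p : R * R => fst p * fst p) (fun p => snd p * snd p)).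
      + apply (continuous_mult (fun p : R * R => fst p) (fun p => fst p)); apply continuous_fst.
      + apply (continuous_mult (fun p : R * R => snd p) (fun p => snd p)); apply continuous_snd.
    - apply continuous_Rinv. simpl. pose proof (Hn x y Hx). lra. }
  exists (x / (x * x + y * y), - y / (x * x + y * y)).
  apply is_Cderive_filterdiff.
  apply (@filterdiff_ext_locally R_AbsRing C_R_NormedModule C_R_NormedModule
    (fun w => (ln (sqrt (fst w ^ 2 + snd w ^ 2)), atan (snd w / fst w)))).
  { generalize Hloc. apply filter_imp. intros [a b] Ha. unfold Clog, Cmod, Carg. simpl in *.
    destruct (Rlt_dec 0 a); [auto | lra]. }
  apply is_Cderive_filterdiff.
  apply (cauchy_riemann (fun x y => ln (sqrt (x ^ 2 + y ^ 2))) (fun x y => atan (y / x))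
    (fun x y => x / (x * x + y * y)) (fun x y => - y / (x * x + y * y)) x y
    (y / (x * x + y * y)) (x / (x * x + y * y))).
  1: generalize Hloc; apply filter_imp; intros [a b] Ha; simpl in *.
  2: generalize Hloc; apply filter_imp; intros [a b] Ha; simpl in *.
  - apply is_derive_ln_norm. auto.
  - pose proof (Hn a b Ha). auto_derive. lra. field. split; nra.
  - apply (is_derive_ext (fun s => ln (sqrt (s ^ 2 + x ^ 2)))).
    { intros s. do 2 f_equal. ring. }
    rewrite (Rplus_comm (x * x)). apply is_derive_ln_norm. rewrite Rplus_comm. auto.
  - pose proof (Hn x y Hx). auto_derive. lra. field. split; nra.
  - apply (Hc fst). apply continuous_fst.
  - apply (Hc (fun p => - snd p)). apply (continuous_opp (fun p : R * R => snd p)). apply continuous_snd.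
  - field. pose proof (Hn x y Hx). lra.
  - reflexivity.
Qed.

Lemma is_Cderive_const (c z : C) : is_Cderive (fun _ => c) z (RtoC 0).
Proof.
  apply is_Cderive_AbsRing. apply (@is_derive_const C_AbsRing (AbsRing_NormedModule C_AbsRing)).
Qed.

Lemma is_Cderive_minus (f g : C -> C) (z df dg : C) :
  is_Cderive f z df -> is_Cderive g z dg -> is_Cderive (fun w => f w - g w)%C z (df - dg)%C.
Proof. apply (@is_derive_minus C_AbsRing C_NormedModule). Qed.

Lemma is_Cderive_id (z : C) : is_Cderive (fun w => w) z (RtoC 1).
Proof. apply is_Cderive_AbsRing. apply (@is_derive_id C_AbsRing). Qed.

Lemma one_minus_re_pos (w : C) : in_disc w -> 0 < fst (1 - w)%C.
Proof.
  unfold in_disc. intros H. pose proof (re_le_Cmod w) as Hr. unfold Re in Hr.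
  pose proof (Rabs_def2 _ _ (Rle_lt_trans _ _ _ Hr H)). simpl. lra.
Qed.

Lemma Cmod_Cpow_pr (u : C) (b : R) : Cmod (Cpow_pr u b) = Rpower (Cmod u) b.
Proof.
  unfold Cpow_pr, Cexp, Clog, Rpower. simpl.
  rewrite Rmult_0_l, Rminus_0_r.
  set (t := b * Carg u + 0 * ln (Cmod u)). set (r := exp (b * ln (Cmod u))).
  replace (r * cos t, r * sin t) with (RtoC r * (cos t, sin t))%C by (C_components; ring).
  rewrite Cmod_mult, Cmod_cos_sin, Cmod_R, Rmult_1_r. apply Rabs_pos_eq, Rlt_le, exp_pos.
Qed.

Lemma Cpow_pr_neq_0 (u : C) (b : R) : Cpow_pr u b <> RtoC 0.
Proof. apply Cmod_gt_0. rewrite Cmod_Cpow_pr. apply exp_pos. Qed.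

Lemma Cpow_pr_derive (w : C) (b : R) : in_disc w ->
  exists d, is_Cderive (fun w => Cpow_pr (1 - w) b) w d.
Proof.
  intros Hw. destruct (Clog_derive (1 - w)%C (one_minus_re_pos w Hw)) as [d Hd].
  eexists. unfold Cpow_pr.
  apply (is_Cderive_comp Cexp (fun w => RtoC b * Clog (1 - w))%C). { apply Cexp_derive. }
  apply (is_Cderive_mult (fun _ => RtoC b) (fun w => Clog (1 - w))%C). { apply is_Cderive_const. }
  apply (is_Cderive_comp Clog (fun w => 1 - w)%C). { exact Hd. }
  apply is_Cderive_minus. apply is_Cderive_const. apply is_Cderive_id.
Qed.

Lemma Ccont_mult (f g : C -> C) (z : C) : Ccont f z -> Ccont g z -> Ccont (fun w => f w * g w)%C z.
Proof.
  intros Hf Hg eps He.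
  set (a := Cmod (f z)). set (b := Cmod (g z)).
  assert (Ha : 0 <= a) by apply Cmod_ge_0. assert (Hb : 0 <= b) by apply Cmod_ge_0.
  destruct (Hf (Rmin 1 (eps / (2 * (b + 1))))) as (e1 & He1 & H1).
  { apply Rmin_pos. lra. apply Rdiv_lt_0_compat; lra. }
  destruct (Hg (Rmin 1 (eps / (2 * (a + 1))))) as (e2 & He2 & H2).
  { apply Rmin_pos. lra. apply Rdiv_lt_0_compat; lra. }
  exists (Rmin e1 e2). split. { apply Rmin_pos; auto. }
  intros w Hw.
  specialize (H1 w (Rlt_le_trans _ _ _ Hw (Rmin_l _ _))).
  specialize (H2 w (Rlt_le_trans _ _ _ Hw (Rmin_r _ _))).
  assert (H1' := Rlt_le_trans _ _ _ H1 (Rmin_r _ _)).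
  assert (H2' := Rlt_le_trans _ _ _ H2 (Rmin_r _ _)).
  assert (H2'' := Rlt_le_trans _ _ _ H2 (Rmin_l _ _)).
  replace (f w * g w - f z * g z)%C with
    ((f w - f z) * ((g w - g z) + g z) + f z * (g w - g z))%C by ring.
  apply Rle_lt_trans with (1 := Cmod_triangle _ _). rewrite !Cmod_mult. fold a.
  assert (H3 : Cmod (g w - g z + g z) <= b + 1).
  { apply Rle_trans with (1 := Cmod_triangle _ _). fold b. lra. }
  assert (H4 : Cmod (f w - f z) * Cmod (g w - g z + g z) <= Cmod (f w - f z) * (b + 1)).
  { apply Rmult_le_compat_l; auto. apply Cmod_ge_0. }
  apply (Rmult_lt_compat_r (b + 1)) in H1'; [|lra].
  apply (Rmult_lt_compat_r (a + 1)) in H2'; [|lra].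
  replace (eps / (2 * (b + 1)) * (b + 1)) with (eps / 2) in H1' by (field; lra).
  replace (eps / (2 * (a + 1)) * (a + 1)) with (eps / 2) in H2' by (field; lra).
  pose proof (Cmod_ge_0 (g w - g z)). nra.
Qed.

(** f(w)/w - d is the remainder in the definition of the derivative at 0, divided by [w]. *)
Lemma analytic_div_id_cont (f : C -> C) (d : C) :
  is_Cderive f (RtoC 0) d -> f (RtoC 0) = RtoC 0 ->
  Ccont (fun w => if excluded_middle_informative (w = RtoC 0) then d else (f w * / w)%C) (RtoC 0).
Proof.
  intros Hd H0 eps He. apply is_Cderive_eps in Hd.
  destruct (Hd (eps / 2) ltac:(lra)) as (e & Hep & Hl). exists e. split; auto.
  intros w Hw. destruct (excluded_middle_informative (RtoC 0 = RtoC 0)) as [_ | H]; [|congruence].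
  destruct (excluded_middle_informative (w = RtoC 0)) as [-> | Hw0].
  - replace (d - d)%C with (RtoC 0) by ring. rewrite Cmod_0. lra.
  - specialize (Hl w Hw). rewrite H0 in Hl.
    replace (f w * / w - d)%C with ((f w - RtoC 0 - (w - RtoC 0) * d) * / w)%C by (field; auto).
    rewrite Cmod_mult, Cmod_inv by auto. replace (w - RtoC 0)%C with w in * by ring.
    pose proof (proj1 (Cmod_gt_0 w) Hw0).
    apply Rle_lt_trans with (eps / 2 * Cmod w * / Cmod w).
    + apply Rmult_le_compat_r; auto. apply Rlt_le, Rinv_0_lt_compat; auto.
    + replace (eps / 2 * Cmod w * / Cmod w) with (eps / 2) by (field; lra). lra.
Qed.

(** The integrability clause serves linearity: [RInt] is total, so additivity has to be justified by
    existence of the integrals. *)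
Lemma cesaro_derive (beta : R) (f : C -> C) :
  analytic_on_disc f -> f (RtoC 0) = RtoC 0 ->
  exists h : C -> C,
    (forall w, in_disc w -> Ccont h w) /\
    (forall w, in_disc w -> w <> RtoC 0 -> h w = f w / (w * Cpow_pr (1 - w) beta))%C /\
    (forall z, in_disc z -> is_Cderive (cesaro beta f) z (h z)) /\
    (forall z, in_disc z -> @ex_RInt C_R_NormedModule
       (fun t : R => ((f (RtoC t * z) / ((RtoC t * z) * Cpow_pr (1 - RtoC t * z) beta)) * z)%C) 0 1) /\
    cesaro beta f (RtoC 0) = RtoC 0.
Proof.
  intros Han H0.
  destruct (Han (RtoC 0) in_disc_0) as [d Hd].
  set (k := fun w => if excluded_middle_informative (w = RtoC 0) then d else (f w * / w)%C).
  set (h := fun w => (k w * / Cpow_pr (1 - w) beta)%C).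
  assert (Hp : forall w, in_disc w -> exists d, is_Cderive (fun w => / Cpow_pr (1 - w) beta)%C w d).
  { intros w Hw. destruct (Cpow_pr_derive w beta Hw) as [e He]. eexists.
    apply (is_Cderive_comp Cinv (fun w => Cpow_pr (1 - w) beta)); [|exact He].
    apply is_Cderive_inv, Cpow_pr_neq_0. }
  assert (hd : forall w, in_disc w -> w <> RtoC 0 -> exists d, is_Cderive h w d).
  { intros w Hw Hw0. destruct (Hp w Hw) as [e He]. destruct (Han w Hw) as [d' Hd'].
    eexists. apply (is_Cderive_mult k (fun w => / Cpow_pr (1 - w) beta)%C); [|exact He].
    apply is_Cderive_filterdiff.
    apply (@filterdiff_ext_locally R_AbsRing C_R_NormedModule C_R_NormedModule (fun w => f w * / w)%C).
    - apply locally_C_eps. exists (Cmod w). split. { apply Cmod_gt_0; auto. }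
      intros x Hx. unfold k. destruct (excluded_middle_informative (x = RtoC 0)) as [-> | _]; auto.
      replace (RtoC 0 - w)%C with (- w)%C in Hx by ring. rewrite Cmod_opp in Hx. lra.
    - apply is_Cderive_filterdiff. apply is_Cderive_mult; [exact Hd' | apply is_Cderive_inv; auto]. }
  assert (hc : forall w, in_disc w -> Ccont h w).
  { intros w Hw. destruct (classic (w = RtoC 0)) as [-> | Hw0].
    - apply Ccont_mult. apply analytic_div_id_cont; auto.
      destruct (Hp _ Hw) as [e He]. eapply is_Cderive_Ccont; exact He.
    - destruct (hd w Hw Hw0) as [e He]. eapply is_Cderive_Ccont; exact He. }
  assert (hf : forall w, w <> RtoC 0 -> h w = (f w / (w * Cpow_pr (1 - w) beta))%C).
  { intros w Hw0. unfold h, k. destruct (excluded_middle_informative (w = RtoC 0)); [congruence|].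
    field. split; auto. apply Cpow_pr_neq_0. }
  (* At t = 0 the integrand of [cesaro] divides by zero. Agreement on the open interval is enough
     for the integrals to coincide, and for [z] = 0 both integrands vanish. *)
  assert (Hi : forall z t, 0 < t < 1 -> seg_integrand h (RtoC 0) z t =
     ((f (RtoC t * z) / ((RtoC t * z) * Cpow_pr (1 - RtoC t * z) beta)) * z)%C).
  { intros z t Ht. unfold seg_integrand.
    replace (RtoC 0 + RtoC t * (z - RtoC 0))%C with (RtoC t * z)%C by ring.
    replace (z - RtoC 0)%C with z by ring.
    destruct (classic (z = RtoC 0)) as [-> | Hz]. { rewrite !(Cmult_0_r (_ / _)), Cmult_0_r. ring. }
    rewrite hf; auto. apply Cmult_neq_0; auto.
    apply Cmod_gt_0. rewrite Cmod_R, Rabs_pos_eq; lra. }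
  assert (Hc : forall z, seg_int h (RtoC 0) z = cesaro beta f z).
  { intros z. unfold seg_int, cesaro. apply (@RInt_ext C_R_CompleteNormedModule).
    intros t Ht. rewrite Rmin_left, Rmax_right in Ht by lra. apply Hi; auto. }
  exists h. repeat match goal with |- _ /\ _ => split end; auto.
  - intros z Hz. apply is_Cderive_filterdiff.
    apply (@filterdiff_ext R_AbsRing C_R_NormedModule C_R_NormedModule _ _ (seg_int h (RtoC 0))); auto.
    apply is_Cderive_filterdiff. apply (disc_primitive h hc hd z Hz).
  - intros z Hz. apply (@ex_RInt_ext C_R_NormedModule (seg_integrand h (RtoC 0) z)).
    { intros t Ht. rewrite Rmin_left, Rmax_right in Ht by lra. apply Hi; auto. }
    apply ex_RInt_seg; try lra. intros t Ht. apply hc. apply segment_disc; auto using in_disc_0.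
  - rewrite <- Hc. apply seg_int_point. apply hc, in_disc_0.
Qed.

(** * Bloch estimates *)

Lemma is_Cderive_unique (f : C -> C) (z d e : C) : is_Cderive f z d -> is_Cderive f z e -> d = e.
Proof. intros H1 H2. apply is_C_derive_unique in H1. apply is_C_derive_unique in H2. congruence. Qed.

Lemma is_Cderive_C_derive (f : C -> C) (z : C) :
  @ex_derive C_AbsRing C_NormedModule f z -> is_Cderive f z (C_derive f z).
Proof. exact (C_derive_correct f z (RtoC 0)). Qed.

Lemma Rpower_pos (x a : R) : 0 < Rpower x a.
Proof. apply exp_pos. Qed.

Lemma exp_le (x y : R) : x <= y -> exp x <= exp y.
Proof. intros [H | ->]; [apply Rlt_le, exp_increasing, H | lra]. Qed.

Lemma Rpower_antitone (x a b : R) : 0 < x <= 1 -> a <= b -> Rpower x b <= Rpower x a.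
Proof.
  intros Hx Hab. unfold Rpower. apply exp_le.
  assert (ln x <= 0). { rewrite <- ln_1. apply ln_le; lra. }
  nra.
Qed.

Lemma Rpower_le_1 (x a : R) : 0 < x <= 1 -> 0 <= a -> Rpower x a <= 1.
Proof. intros Hx Ha. rewrite <- (Rpower_O x) by lra. apply Rpower_antitone; auto. Qed.

Lemma one_minus_sq_bounds (r a : R) : 0 <= r < 1 -> 0 <= a ->
  Rpower (1 - r) a <= Rpower (1 - r ^ 2) a <= Rpower 2 a * Rpower (1 - r) a /\ Rpower (1 - r ^ 2) a <= 1.
Proof.
  intros Hr Ha. split; [split|].
  - apply Rle_Rpower_l; auto. nra.
  - rewrite Rpower_mult_distr by lra. apply Rle_Rpower_l; auto. nra.
  - apply Rpower_le_1; auto. nra.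
Qed.

Lemma bloch_bound_nonneg (alpha : R) (f : C -> C) (M : R) :
  analytic_on_disc f -> bloch_bound alpha f M -> 0 <= M.
Proof.
  intros Han Hb. apply Rle_trans with (2 := Hb _ _ in_disc_0 (is_Cderive_C_derive _ _ (Han _ in_disc_0))).
  apply Rmult_le_pos. apply Rlt_le, Rpower_pos. apply Cmod_ge_0.
Qed.

Section Estimates.

Context (alpha beta gam b : R)
  (Ha : 0 < alpha) (Hg : 0 < gam) (Hb : 0 <= b) (Hab : alpha <= gam + 1) (Hbb : beta <= b)
  (Hs : gam + b < alpha).

(** Weakening the exponent [alpha] to [gam + 1] > 1 makes the bound integrate to a power of 1 - |z|
    in every case, without a logarithm at [alpha] = 1. *)
Lemma bloch_derive_le (f : C -> C) (M : R) (w : C) :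
  analytic_on_disc f -> bloch_bound alpha f M -> in_disc w ->
  Cmod (C_derive f w) <= M * Rpower (1 - Cmod w) (- (gam + 1)).
Proof.
  intros Han HM Hw. pose proof (Cmod_ge_0 w) as H0. unfold in_disc in Hw.
  pose proof (HM w _ Hw (is_Cderive_C_derive _ _ (Han _ Hw))) as H.
  destruct (one_minus_sq_bounds (Cmod w) alpha) as [[H1 _] _]; try lra.
  pose proof (Rpower_antitone (1 - Cmod w) alpha (gam + 1) ltac:(lra) Hab) as H2.
  rewrite Rpower_Ropp. pose proof (Rpower_pos (1 - Cmod w) (gam + 1)) as H3.
  pose proof (Cmod_ge_0 (C_derive f w)).
  apply (Rmult_le_reg_r (Rpower (1 - Cmod w) (gam + 1))); auto.
  rewrite Rmult_assoc, Rinv_l, Rmult_1_r by lra.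
  apply Rle_trans with (2 := H). rewrite Rmult_comm. apply Rmult_le_compat_r; lra.
Qed.

Lemma bloch_growth (f : C -> C) (M : R) (z : C) :
  analytic_on_disc f -> f (RtoC 0) = RtoC 0 -> bloch_bound alpha f M -> in_disc z ->
  Cmod (f z) <= M / gam * Rpower (1 - Cmod z) (- gam).
Proof.
  intros Han H0 HM Hz. pose proof (Cmod_ge_0 z) as Hz0.
  pose proof (bloch_bound_nonneg alpha f M Han HM) as HM0.
  set (r := Cmod z) in *.
  assert (Hin : forall t, 0 <= t <= 1 -> Cmod (RtoC 0 + RtoC t * z) = t * r).
  { intros t Ht. rewrite Cplus_0_l, Cmod_mult, Cmod_R, Rabs_pos_eq; auto; lra. }
  unfold in_disc in Hz. fold r in Hz.
  assert (Htr : forall t, 0 <= t <= 1 -> t * r < 1) by (intros; nra).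
  assert (H : Cmod (f (RtoC 0 + RtoC 1 * z)%C - f (RtoC 0 + RtoC 0 * z)%C) <=
     M / gam * Rpower (1 - 1 * r) (- gam) - M / gam * Rpower (1 - 0 * r) (- gam)).
  (* The majorant M/gam (1 - t r)^(-gam) is chosen because its derivative in [t] is exactly the
     bound of [bloch_derive_le] along the radius. *)
  { apply (path_increment_bound (fun t => f (RtoC 0 + RtoC t * z)%C)
      (fun t => C_derive f (RtoC 0 + RtoC t * z) * z)%C
      (fun t => M / gam * Rpower (1 - t * r) (- gam))
      (fun t => M * Rpower (1 - t * r) (- (gam + 1)) * r)).
    - intros t Ht. apply (is_path_derive_comp f (fun t => (RtoC 0 + RtoC t * z)%C)).
      + apply is_Cderive_C_derive, Han. unfold in_disc. rewrite Hin; auto.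
      + apply is_path_derive_line.
    - intros t Ht. specialize (Htr t Ht).
      replace (Rpower (1 - t * r) (- (gam + 1))) with (Rpower (1 - t * r) (- gam) * / (1 - t * r)).
      2:{ replace (- (gam + 1)) with (- gam + - (1)) by ring.
          rewrite Rpower_plus, (Rpower_Ropp _ 1), Rpower_1; auto. lra. }
      unfold Rpower. auto_derive. lra.
      change (1 + - (t * r)) with (1 - t * r). field. lra.
    - intros t Ht. rewrite Cmod_mult. fold r. apply Rmult_le_compat_r; auto.
      rewrite <- Hin by auto. apply bloch_derive_le; auto. unfold in_disc. rewrite Hin; auto. }
  replace (RtoC 0 + RtoC 1 * z)%C with z in H by ring.
  replace (RtoC 0 + RtoC 0 * z)%C with (RtoC 0) in H by ring.
  rewrite H0 in H. replace (f z - RtoC 0)%C with (f z) in H by ring.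
  replace (1 - 1 * r) with (1 - r) in H by ring.
  assert (0 <= M / gam * Rpower (1 - 0 * r) (- gam)).
  { apply Rmult_le_pos. apply Rdiv_le_0_compat; auto. apply Rlt_le, Rpower_pos. }
  lra.
Qed.

(** [bloch_growth] does not vanish at 0, so control of f(z)/z near 0 comes from a Lipschitz bound
    instead. *)
Lemma bloch_growth_0 (f : C -> C) (M : R) (z : C) :
  analytic_on_disc f -> f (RtoC 0) = RtoC 0 -> bloch_bound alpha f M -> Cmod z <= / 2 ->
  Cmod (f z) <= M * Rpower 2 (gam + 1) * Cmod z.
Proof.
  intros Han H0 HM Hz.
  pose proof (bloch_bound_nonneg alpha f M Han HM) as HM0.
  replace (f z) with (f z - f (RtoC 0))%C by (rewrite H0; ring).
  replace (Cmod z) with (Cmod (z - RtoC 0)) by (f_equal; ring).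
  apply (Cmod_increment_le f (C_derive f)). intros t Ht w.
  assert (Hw : Cmod w <= / 2).
  { apply Cmod_segment_le; auto. rewrite Cmod_0. lra. }
  assert (Hd : in_disc w) by (unfold in_disc; lra).
  split. { apply is_Cderive_C_derive, Han, Hd. }
  apply Rle_trans with (1 := bloch_derive_le f M w Han HM Hd).
  apply Rmult_le_compat_l; auto. rewrite Rpower_Ropp.
  pose proof (Rpower_pos (1 - Cmod w) (gam + 1)).
  apply (Rmult_le_reg_l (Rpower (1 - Cmod w) (gam + 1))); auto.
  rewrite Rinv_r by lra. rewrite Rpower_mult_distr by lra.
  replace 1 with (Rpower 1 (gam + 1)) at 1.
  - apply Rle_Rpower_l; lra.
  - unfold Rpower. rewrite ln_1, Rmult_0_r. apply exp_0.
Qed.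

(** The first entry serves |z| > 1/2, where 1 <= 2|z| turns [bloch_growth] into a bound with a
    factor |z|; the second serves |z| <= 1/2. *)
Let C0 := Rmax (2 / gam) (Rpower 2 (gam + 1)).
(** For beta >= 0 use |1 - z| >= 1 - |z|, with constant 1. For beta < 0 the power does not
    degenerate, and |1 - z| <= 2 gives 2^beta. *)
Let c1 := Rmin 1 (Rpower 2 beta).

Lemma denominator_constant_pos : 0 < c1.
Proof. apply Rmin_pos. lra. apply Rpower_pos. Qed.

Lemma growth_constant_pos : 0 < C0.
Proof. apply Rlt_le_trans with (Rpower 2 (gam + 1)). apply Rpower_pos. apply Rmax_r. Qed.

Lemma bloch_growth_div (f : C -> C) (M : R) (z : C) :
  analytic_on_disc f -> f (RtoC 0) = RtoC 0 -> bloch_bound alpha f M -> in_disc z ->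
  Cmod (f z) <= C0 * M * Rpower (1 - Cmod z) (- gam) * Cmod z.
Proof.
  intros Han H0 HM Hz. pose proof (Cmod_ge_0 z).
  pose proof (bloch_bound_nonneg alpha f M Han HM) as HM0. unfold in_disc in Hz.
  destruct (Rle_lt_dec (Cmod z) (/ 2)) as [Hh | Hh].
  - apply Rle_trans with (1 := bloch_growth_0 f M z Han H0 HM Hh).
    apply Rmult_le_compat_r; auto.
    assert (1 <= Rpower (1 - Cmod z) (- gam)).
    { rewrite <- (Rpower_O (1 - Cmod z)) at 1 by lra. apply Rpower_antitone; lra. }
    assert (Rpower 2 (gam + 1) <= C0) by apply Rmax_r.
    assert (M * Rpower 2 (gam + 1) <= M * C0) by (apply Rmult_le_compat_l; auto).
    pose proof growth_constant_pos. assert (0 <= M * C0) by nra. nra.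
  - apply Rle_trans with (1 := bloch_growth f M z Han H0 HM Hz).
    replace (C0 * M * Rpower (1 - Cmod z) (- gam) * Cmod z) with
      (C0 * Cmod z * M * Rpower (1 - Cmod z) (- gam)) by ring.
    apply Rmult_le_compat_r. apply Rlt_le, Rpower_pos.
    unfold Rdiv. rewrite Rmult_comm. apply Rmult_le_compat_r; auto.
    assert (2 / gam <= C0) by apply Rmax_l.
    assert (0 < / gam) by (apply Rinv_0_lt_compat; auto). unfold Rdiv in *. nra.
Qed.

Lemma denominator_bound (z : C) : in_disc z ->
  c1 * Rpower (1 - Cmod z) b <= Cmod (Cpow_pr (1 - z) beta).
Proof.
  intros Hz. unfold in_disc in Hz. rewrite Cmod_Cpow_pr. pose proof (Cmod_ge_0 z).
  assert (Hl : 1 - Cmod z <= Cmod (1 - z)).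
  { pose proof (Cmod_triangle (1 - z) z) as Ht. replace (1 - z + z)%C with (RtoC 1) in Ht by ring.
    rewrite Cmod_1 in Ht. lra. }
  assert (Hu : Cmod (1 - z) <= 2).
  { apply Rle_trans with (1 := Cmod_triangle _ _). rewrite Cmod_opp, Cmod_1. lra. }
  pose proof (Rpower_le_1 (1 - Cmod z) b ltac:(lra) Hb).
  pose proof (Rpower_pos (1 - Cmod z) b). pose proof denominator_constant_pos.
  destruct (Rle_lt_dec 0 beta) as [Hbe | Hbe].
  - apply Rle_trans with (Rpower (1 - Cmod z) b).
    { assert (c1 <= 1) by apply Rmin_l. nra. }
    apply Rle_trans with (Rpower (1 - Cmod z) beta).
    + apply Rpower_antitone; lra.
    + apply Rle_Rpower_l; lra.
  - apply Rle_trans with (Rpower 2 beta).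
    { assert (c1 <= Rpower 2 beta) by apply Rmin_r. nra. }
    unfold Rpower. apply exp_le.
    assert (ln (Cmod (1 - z)) <= ln 2) by (apply ln_le; lra). nra.
Qed.

Lemma integrand_bound (f h : C -> C) (z : C) :
  in_disc z -> z <> RtoC 0 -> h z = (f z / (z * Cpow_pr (1 - z) beta))%C ->
  Cmod (h z) <= Cmod (f z) / Cmod z * (/ c1 * Rpower (1 - Cmod z) (- b)).
Proof.
  intros Hz Hz0 ->. pose proof (proj1 (Cmod_gt_0 z) Hz0).
  rewrite Cmod_div by (apply Cmult_neq_0; auto using Cpow_pr_neq_0).
  rewrite Cmod_mult. unfold Rdiv. rewrite Rinv_mult, <- Rmult_assoc.
  apply Rmult_le_compat_l.
  { apply Rmult_le_pos. apply Cmod_ge_0. apply Rlt_le, Rinv_0_lt_compat; auto. }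
  rewrite Rpower_Ropp, <- Rinv_mult. apply Rinv_le_contravar.
  - apply Rmult_lt_0_compat. apply denominator_constant_pos. apply Rpower_pos.
  - apply denominator_bound; auto.
Qed.

(** The factor 2^alpha is the cost of replacing 1 - |z|^2 by 1 - |z|. *)
Let C1 := Rpower 2 alpha * (C0 / c1).

Lemma weighted_constant_pos : 0 < C1.
Proof.
  apply Rmult_lt_0_compat. apply Rpower_pos. apply Rdiv_lt_0_compat. apply growth_constant_pos. apply denominator_constant_pos.
Qed.

Lemma weighted_bound (f h : C -> C) (M : R) (z : C) :
  analytic_on_disc f -> f (RtoC 0) = RtoC 0 -> bloch_bound alpha f M ->
  in_disc z -> z <> RtoC 0 -> h z = (f z / (z * Cpow_pr (1 - z) beta))%C ->
  Rpower (1 - Cmod z ^ 2) alpha * Cmod (h z) <= C1 * M * Rpower (1 - Cmod z) (alpha - gam - b).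
Proof.
  intros Han H0 HM Hz Hz0 Hh.
  pose proof (integrand_bound f h z Hz Hz0 Hh) as H1.
  pose proof (bloch_growth_div f M z Han H0 HM Hz) as H2.
  pose proof (proj1 (Cmod_gt_0 z) Hz0) as Hp. unfold in_disc in Hz.
  destruct (one_minus_sq_bounds (Cmod z) alpha) as [[_ H3] _]; try lra.
  pose proof denominator_constant_pos as Hc1.
  assert (H4 : Cmod (h z) <= C0 * M * Rpower (1 - Cmod z) (- gam) * (/ c1 * Rpower (1 - Cmod z) (- b))).
  { apply Rle_trans with (1 := H1). apply Rmult_le_compat_r.
    - apply Rmult_le_pos. apply Rlt_le, Rinv_0_lt_compat, Hc1. apply Rlt_le, Rpower_pos.
    - apply (Rmult_le_reg_r (Cmod z)); auto. unfold Rdiv. rewrite Rmult_assoc, Rinv_l by lra. lra. }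
  apply Rle_trans with (Rpower 2 alpha * Rpower (1 - Cmod z) alpha *
    (C0 * M * Rpower (1 - Cmod z) (- gam) * (/ c1 * Rpower (1 - Cmod z) (- b)))).
  - apply Rmult_le_compat; auto. apply Rlt_le, Rpower_pos. apply Cmod_ge_0.
  - right. replace (alpha - gam - b) with (alpha + - gam + - b) by ring.
    rewrite !Rpower_plus. unfold C1. field. lra.
Qed.

(** To be applied to differences of two members of the unit ball, hence the Bloch bound 2. The
    radius [r] and the tolerance [eta] depend on [eps] only, not on [u]. *)
Lemma cesaro_small (eps : R) : 0 < eps -> exists r eta, 0 < r < 1 /\ 0 < eta /\
  forall u h H : C -> C,
    analytic_on_disc u -> u (RtoC 0) = RtoC 0 -> bloch_bound alpha u 2 ->
    (forall w, in_disc w -> Ccont h w) ->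
    (forall w, in_disc w -> w <> RtoC 0 -> h w = u w / (w * Cpow_pr (1 - w) beta))%C ->
    (forall w, in_disc w -> is_Cderive H w (h w)) ->
    (forall w, Cmod w <= r -> Cmod (u w) <= eta) ->
    forall z, in_disc z -> Rpower (1 - Cmod z ^ 2) alpha * Cmod (h z) <= eps.
Proof.
  intros Heps. pose proof weighted_constant_pos as HC1. pose proof denominator_constant_pos as Hc1.
  set (s := alpha - gam - b). assert (Hs0 : 0 < s) by (unfold s; lra).
  set (e := eps / (C1 * 2)). assert (He : 0 < e) by (apply Rdiv_lt_0_compat; lra).
  (* Width of the boundary annulus: there [weighted_bound] gives at most C1 * 2 * x^s <= eps. *)
  set (x := Rmin (/ 2) (Rpower e (/ s))).
  assert (Hx : 0 < x) by (apply Rmin_pos; [lra | apply Rpower_pos]).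
  assert (Hx2 : x <= / 2) by apply Rmin_l.
  assert (Hxs : Rpower x s <= e).
  { apply Rle_trans with (Rpower (Rpower e (/ s)) s).
    - apply Rle_Rpower_l. lra. split; auto. apply Rmin_r.
    - rewrite Rpower_mult, Rinv_l, Rpower_1; lra. }
  (* On 1/8 <= |w| <= 1 - x, dividing by [w] and by (1 - w)^beta enlarges |u| by at most this
     factor. *)
  set (K := 8 * (/ c1 * Rpower x (- b))).
  assert (HK : 0 < K).
  { pose proof (Rinv_0_lt_compat _ Hc1). pose proof (Rpower_pos x (- b)). unfold K. nra. }
  exists (1 - x), (eps / K). split. lra. split. { apply Rdiv_lt_0_compat; auto. }
  intros u h H Han H0 HM hc hu HH Hsm z Hz. pose proof Hz as Hz'. unfold in_disc in Hz.
  assert (Hmid : forall w, / 8 <= Cmod w <= 1 - x -> Cmod (h w) <= eps).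
  { intros w Hw. assert (Hwd : in_disc w) by (unfold in_disc; lra).
    assert (Hw0 : w <> RtoC 0) by (apply Cmod_gt_0; lra).
    apply Rle_trans with (1 := integrand_bound u h w Hwd Hw0 (hu w Hwd Hw0)).
    apply Rle_trans with (eps / K * 8 * (/ c1 * Rpower x (- b))).
    - apply Rmult_le_compat.
      + apply Rdiv_le_0_compat. apply Cmod_ge_0. lra.
      + apply Rmult_le_pos. apply Rlt_le, Rinv_0_lt_compat, Hc1. apply Rlt_le, Rpower_pos.
      + unfold Rdiv at 1. apply Rmult_le_compat.
        * apply Cmod_ge_0.
        * apply Rlt_le, Rinv_0_lt_compat. lra.
        * apply Hsm. lra.
        * replace 8 with (/ / 8) by field. apply Rinv_le_contravar; lra.
      + apply Rmult_le_compat_l. apply Rlt_le, Rinv_0_lt_compat, Hc1.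
        rewrite !Rpower_Ropp. apply Rinv_le_contravar. apply Rpower_pos.
        apply Rle_Rpower_l; lra.
    - pose proof (Rpower_pos x (- b)). right. unfold K. field. split; lra. }
  pose proof (Cmod_ge_0 z) as Hz0.
  destruct (one_minus_sq_bounds (Cmod z) alpha) as [_ Hw1]; try lra.
  assert (Hin : Cmod (h z) <= eps -> Rpower (1 - Cmod z ^ 2) alpha * Cmod (h z) <= eps).
  { intros Hle. pose proof (Cmod_ge_0 (h z)). pose proof (Rpower_pos (1 - Cmod z ^ 2) alpha). nra. }
  destruct (Rle_lt_dec (Cmod z) (1 - x)) as [Hzx | Hzx].
  - apply Hin. destruct (Rle_lt_dec (/ 8) (Cmod z)) as [H8 | H8]. { apply Hmid. lra. }
    (* For |z| < 1/8 this circle lies in 1/8 <= |w| <= 3/8, within reach of [Hmid] because 1 - x >=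
       1/2. *)
    apply (circle_max h H z (/ 4) eps hc HH); try lra.
    intros w Hw. apply Hmid.
    pose proof (Cmod_triangle (w - z) z) as T1. replace (w - z + z)%C with w in T1 by ring.
    pose proof (Cmod_triangle w (- z)) as T2. rewrite Cmod_opp in T2.
    change (w + - z)%C with (w - z)%C in T2. lra.
  - assert (Hzn : z <> RtoC 0) by (apply Cmod_gt_0; lra).
    apply Rle_trans with (1 := weighted_bound u h 2 z Han H0 HM Hz' Hzn (hu z Hz' Hzn)). fold s.
    apply Rle_trans with (C1 * 2 * e).
    + apply Rmult_le_compat_l. lra. apply Rle_trans with (2 := Hxs). apply Rle_Rpower_l; lra.
    + right. unfold e. field. lra.
Qed.

Lemma cesaro_in_Bloch0 (f : C -> C) : in_Bloch0 alpha f -> in_Bloch0 alpha (cesaro beta f).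
Proof.
  intros [[Han [M HM]] H0].
  destruct (cesaro_derive beta f Han H0) as (h & hc & hf & hd & _ & h0).
  split; [split|]; auto.
  - intros z Hz. exists (h z). auto.
  (* [weighted_bound] covers z <> 0 only, so the value at the origin is added. *)
  - exists (C1 * M + Cmod (h (RtoC 0))). intros z d Hz Hd.
    rewrite (is_Cderive_unique _ _ _ _ Hd (hd z Hz)).
    pose proof (bloch_bound_nonneg alpha f M Han HM) as HM0. pose proof weighted_constant_pos as HC1.
    pose proof (Cmod_ge_0 (h (RtoC 0))). pose proof (Cmod_ge_0 z).
    pose proof Hz as Hz'. unfold in_disc in Hz'.
    destruct (classic (z = RtoC 0)) as [-> | Hz0].
    + destruct (one_minus_sq_bounds (Cmod (RtoC 0)) alpha) as [_ Hw1]; try lra.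
      pose proof (Rpower_pos (1 - Cmod (RtoC 0) ^ 2) alpha). nra.
    + apply Rle_trans with (1 := weighted_bound f h M z Han H0 HM Hz Hz0 (hf z Hz Hz0)).
      pose proof (Rpower_le_1 (1 - Cmod z) (alpha - gam - b) ltac:(lra) ltac:(lra)).
      assert (0 <= C1 * M) by nra. nra.
Qed.

End Estimates.

(** * Extraction of subsequences and weighted limits *)

Lemma exists_choice {A B : Type} (P : A -> B -> Prop) :
  (forall x, exists y, P x y) -> exists f, forall x, P x (f x).
Proof.
  intros H. exists (fun x => proj1_sig (constructive_indefinite_description _ (H x))).
  intros x. apply proj2_sig.
Qed.

(** The integral is linear over R; a complex factor has to be pulled out through real and imaginary
    parts. *)
Lemma is_RInt_Cmult (c : C) (f : R -> C) (a b : R) (l : C) :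
  @is_RInt C_R_NormedModule f a b l ->
  @is_RInt C_R_NormedModule (fun t => c * f t)%C a b (c * l)%C.
Proof.
  intros H.
  pose proof (@is_RInt_fct_extend_fst R_NormedModule R_NormedModule _ _ _ _ H) as H1.
  pose proof (@is_RInt_fct_extend_snd R_NormedModule R_NormedModule _ _ _ _ H) as H2.
  apply (@is_RInt_fct_extend_pair R_NormedModule R_NormedModule); simpl.
  - apply (@is_RInt_minus R_NormedModule); apply (@is_RInt_scal R_NormedModule); auto.
  - apply (@is_RInt_plus R_NormedModule); apply (@is_RInt_scal R_NormedModule); auto.
Qed.

Lemma cesaro_linear (beta : R) (f g : C -> C) (a z : C) :
  analytic_on_disc f -> f (RtoC 0) = RtoC 0 -> analytic_on_disc g -> g (RtoC 0) = RtoC 0 ->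
  in_disc z ->
  cesaro beta (fun w => (a * f w + g w)%C) z = (a * cesaro beta f z + cesaro beta g z)%C.
Proof.
  intros Hf Hf0 Hg Hg0 Hz.
  destruct (cesaro_derive beta f Hf Hf0) as (_ & _ & _ & _ & If & _).
  destruct (cesaro_derive beta g Hg Hg0) as (_ & _ & _ & _ & Ig & _).
  specialize (If z Hz). specialize (Ig z Hz).
  apply (@RInt_correct C_R_CompleteNormedModule) in If.
  apply (@RInt_correct C_R_CompleteNormedModule) in Ig.
  apply (@is_RInt_unique C_R_CompleteNormedModule).
  pose proof (@is_RInt_plus C_R_NormedModule _ _ _ _ _ _ (is_RInt_Cmult a _ _ _ _ If) Ig) as I.
  refine (@is_RInt_ext C_R_NormedModule _ _ _ _ _ _ I).
  intros t _. change (@plus C_R_NormedModule) with Cplus. unfold Cdiv.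
  match goal with |- ?x = ?y => change (@eq C x y) end. ring.
Qed.

(** Infinite index sets stand in for subsequences, so that successive refinements are inclusions
    rather than compositions of reindexings. *)
Definition unbounded (S : nat -> Prop) := forall N, exists n, (N <= n)%nat /\ S n.

(** Build decreasing infinite sets [T j], each satisfying [D j], and pick [phi j] in [T j]; then
    every [phi n] with n >= j lies in [T j]. *)
Lemma diagonal_extraction (D : nat -> nat -> nat -> Prop) :
  (forall j S, unbounded S -> exists S', (forall n, S' n -> S n) /\ unbounded S' /\
     forall n m, S' n -> S' m -> D j n m) ->
  exists phi : nat -> nat, (forall n, (phi n < phi (S n))%nat) /\
    forall j n m, (j <= n)%nat -> (j <= m)%nat -> D j (phi n) (phi m).
Proof.
  intros H.
  (* Infiniteness is a premise inside the relation, so the chosen [F] is total and can be iterated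
     first; that its sets are infinite follows by induction. *)
  destruct (exists_choice (fun (x : nat * (nat -> Prop)) S' => unbounded (snd x) ->
    (forall n, S' n -> snd x n) /\ unbounded S' /\ forall n m, S' n -> S' m -> D (fst x) n m)) as [F HF].
  { intros [j S0]. simpl. destruct (classic (unbounded S0)) as [HS | HS].
    - destruct (H j S0 HS) as [S' HS']. exists S'; auto.
    - exists S0. tauto. }
  set (T := nat_rect (fun _ => nat -> Prop) (F (0%nat, fun _ => True)) (fun j S0 => F (S j, S0))).
  assert (HT0 : unbounded (fun _ => True)) by (intros N; exists N; auto).
  assert (HTu : forall j, unbounded (T j)).
  { induction j as [|j IH]; simpl; apply HF; auto. }
  assert (HTD : forall j n m, T j n -> T j m -> D j n m).
  { intros [|j]; simpl.
    - apply (HF (0%nat, fun _ => True) HT0).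
    - apply (HF (S j, T j) (HTu j)). }
  assert (HTS : forall i j, (i <= j)%nat -> forall n, T j n -> T i n).
  { intros i j Hij. induction Hij as [|j Hij IH]; auto.
    intros n Hn. apply IH. apply (HF (S j, T j) (HTu j)). exact Hn. }
  destruct (exists_choice (fun (x : nat * nat) n => (snd x <= n)%nat /\ T (fst x) n)) as [pick Hpick].
  { intros [j N]. destruct (HTu j N) as [n Hn]. exists n. exact Hn. }
  set (phi := nat_rect (fun _ => nat) (pick (0%nat, 0%nat)) (fun j p => pick (S j, S p))).
  exists phi. split.
  - intros n. destruct (Hpick (S n, S (phi n))) as [H1 _]. exact H1.
  - assert (Hphi : forall j, T j (phi j)).
    { intros [|j]; simpl; [apply (Hpick (0%nat, 0%nat)) | apply (Hpick (S j, S (phi j)))]. }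
    intros j n m Hn Hm. apply HTD; [apply (HTS j n) | apply (HTS j m)]; auto.
Qed.

(** Induction on the number of cells of length [eps]: either the lowest cell contains infinitely
    many terms, or beyond some index all terms lie in the other cells. *)
Lemma pigeonhole_real (u : nat -> R) (eps : R) (K : nat) : 0 <= eps ->
  forall (S : nat -> Prop) (a : R), unbounded S -> (forall n, S n -> a <= u n <= a + INR K * eps) ->
  exists S', (forall n, S' n -> S n) /\ unbounded S' /\
     forall n m, S' n -> S' m -> Rabs (u n - u m) <= eps.
Proof.
  intros He. induction K as [|K IH]; intros S a HS Hu.
  - exists S. split; [|split]; auto. intros n m Hn Hm.
    pose proof (Hu n Hn). pose proof (Hu m Hm). simpl in *.
    apply Rabs_le; lra.
  - destruct (classic (unbounded (fun n => S n /\ u n <= a + eps))) as [H | H].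
    + exists (fun n => S n /\ u n <= a + eps). split; [|split]; auto. { tauto. }
      intros n m [Hn Hn'] [Hm Hm']. pose proof (Hu n Hn). pose proof (Hu m Hm). apply Rabs_le; lra.
    + apply not_all_ex_not in H. destruct H as [N HN].
      assert (HN' : forall n, (N <= n)%nat -> S n -> a + eps < u n).
      { intros n Hn HSn. apply Rnot_le_lt. intros Hle. apply HN. exists n. auto. }
      destruct (IH (fun n => S n /\ (N <= n)%nat) (a + eps)) as (S' & H1 & H2 & H3).
      * intros M. destruct (HS (max M N)) as (n & Hn & HSn). exists n. split; [lia | split; auto; lia].
      * intros n [HSn Hn]. specialize (HN' n Hn HSn). specialize (Hu n HSn).
        rewrite S_INR in Hu. lra.
      * exists S'. split; [|split]; auto. intros n Hn. apply H1; auto.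
Qed.

Lemma pigeonhole_C (u : nat -> C) (B eps : R) (S : nat -> Prop) :
  0 < eps -> unbounded S -> (forall n, Cmod (u n) <= B) ->
  exists S', (forall n, S' n -> S n) /\ unbounded S' /\
     forall n m, S' n -> S' m -> Cmod (u n - u m) <= eps.
Proof.
  intros He HS HB.
  destruct (INR_archimed (eps / 2) (2 * B) ltac:(lra)) as [K HK].
  destruct (pigeonhole_real (fun n => fst (u n)) (eps / 2) K ltac:(lra) S (- B) HS) as (S1 & H1 & HS1 & D1).
  { intros n _. pose proof (Rle_trans _ _ _ (re_le_Cmod (u n)) (HB n)) as H. unfold Re in H.
    apply Rcomplements.Rabs_le_between in H. lra. }
  destruct (pigeonhole_real (fun n => snd (u n)) (eps / 2) K ltac:(lra) S1 (- B) HS1) as (S2 & H2 & HS2 & D2).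
  { intros n _. pose proof (Rle_trans _ _ _ (Rmax_r _ _) (Rle_trans _ _ _ (Rmax_Cmod (u n)) (HB n))) as H.
    apply Rcomplements.Rabs_le_between in H. lra. }
  exists S2. split; [|split]; auto. intros n m Hn Hm.
  specialize (D1 n m (H2 n Hn) (H2 m Hm)). specialize (D2 n m Hn Hm).
  replace (u n - u m)%C with (RtoC (fst (u n) - fst (u m)) + Ci * RtoC (snd (u n) - snd (u m)))%C
    by (C_components; ring).
  apply Rle_trans with (1 := Cmod_triangle _ _).
  rewrite Cmod_mult, Cmod_Ci, !Cmod_R. lra.
Qed.

(** The predicate [P] filters the net: its grid covers a square, and values are bounded only at
    points well inside the disc. *)
Lemma pigeonhole_list (f : nat -> C -> C) (P : C -> Prop) (eps : R) (l : list C) :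
  0 < eps -> (forall p, P p -> exists B, forall n, Cmod (f n p) <= B) ->
  forall S, unbounded S ->
  exists S', (forall n, S' n -> S n) /\ unbounded S' /\
     forall n m p, In p l -> P p -> S' n -> S' m -> Cmod (f n p - f m p) <= eps.
Proof.
  intros He HB. induction l as [|p l IH]; intros S HS.
  - exists S. split; [|split]; auto. intros n m p [].
  - destruct (IH S HS) as (S1 & H1 & HS1 & D1).
    destruct (classic (P p)) as [Hp | Hp].
    + destruct (HB p Hp) as [B HBp].
      destruct (pigeonhole_C (fun n => f n p) B eps S1 He HS1 HBp) as (S2 & H2 & HS2 & D2).
      exists S2. split; [|split]; auto.
      intros n m q [<- | Hq] HPq Hn Hm; auto.
    + exists S1. split; [|split]; auto.
      intros n m q [<- | Hq] HPq Hn Hm; [contradiction | auto].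
Qed.

Lemma finite_net (eps : R) : 0 < eps ->
  exists l : list C, forall z, Cmod z <= 1 -> exists p, In p l /\ Cmod (z - p) <= eps.
Proof.
  intros He.
  assert (Hl : forall K, exists l : list R, forall x, -1 <= x <= -1 + INR K * (eps / 2) ->
     exists p, In p l /\ Rabs (x - p) <= eps / 2).
  { induction K as [|K [l Hl]].
    - exists (-1 :: nil). intros x Hx. simpl in Hx. exists (-1). split. left; auto. apply Rabs_le; lra.
    - exists ((-1 + INR K * (eps / 2)) :: l). intros x Hx. rewrite S_INR in Hx.
      destruct (Rle_lt_dec x (-1 + INR K * (eps / 2))) as [H | H].
      + destruct (Hl x ltac:(lra)) as (p & Hp & Hxp). exists p. split; auto. right; auto.
      + exists (-1 + INR K * (eps / 2)). split. left; auto. apply Rabs_le; lra. }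
  destruct (INR_archimed (eps / 2) 2 ltac:(lra)) as [K HK].
  destruct (Hl K) as [l Hl']. exists (list_prod l l). intros z Hz.
  pose proof (Rle_trans _ _ _ (re_le_Cmod z) Hz) as H1. unfold Re in H1.
  apply Rcomplements.Rabs_le_between in H1.
  pose proof (Rle_trans _ _ _ (Rmax_r _ _) (Rle_trans _ _ _ (Rmax_Cmod z) Hz)) as H2.
  apply Rcomplements.Rabs_le_between in H2.
  destruct (Hl' (fst z) ltac:(lra)) as (p & Hp & Hzp).
  destruct (Hl' (snd z) ltac:(lra)) as (q & Hq & Hzq).
  exists (p, q). split. { apply in_prod; auto. }
  replace (z - (p, q))%C with (RtoC (fst z - p) + Ci * RtoC (snd z - q))%C by (C_components; ring).
  apply Rle_trans with (1 := Cmod_triangle _ _).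
  rewrite Cmod_mult, Cmod_Ci, !Cmod_R. lra.
Qed.

(** Increments of [G n - G m] are controlled by [k n - k m] along the segment. Together with [G n 0]
    = 0 this gives convergence of the [G n], and it is what transfers differentiability to the
    limit. *)
Lemma weighted_limit (alpha : R) (G k : nat -> C -> C) :
  0 < alpha ->
  (forall n z, in_disc z -> is_Cderive (G n) z (k n z)) ->
  (forall n, G n (RtoC 0) = RtoC 0) ->
  (forall j n m z, (j <= n)%nat -> (j <= m)%nat -> in_disc z ->
     Rpower (1 - Cmod z ^ 2) alpha * Cmod (k n z - k m z) <= / (INR j + 1)) ->
  exists g kinf : C -> C,
    g (RtoC 0) = RtoC 0 /\ (forall z, in_disc z -> is_Cderive g z (kinf z)) /\
    (forall n z, in_disc z -> Rpower (1 - Cmod z ^ 2) alpha * Cmod (k n z - kinf z) <= / (INR n + 1)).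
Proof.
  intros Ha HG HG0 HC.
  set (W := fun r => Rpower (1 - r ^ 2) alpha).
  assert (HW : forall r, 0 < W r) by (intros; apply Rpower_pos).
  assert (Hj : forall n, 0 < INR n + 1) by (intros n; pose proof (pos_INR n); lra).
  assert (HK : forall r j n m z, (j <= n)%nat -> (j <= m)%nat -> Cmod z <= r -> r < 1 ->
     Cmod (k n z - k m z) <= / (INR j + 1) / W r).
  { intros r j n m z Hn Hm Hz Hr. pose proof (Cmod_ge_0 z).
    assert (Hzd : in_disc z) by (unfold in_disc; lra).
    apply (Rmult_le_reg_l (W r)); auto.
    replace (W r * (/ (INR j + 1) / W r)) with (/ (INR j + 1))
      by (field; pose proof (HW r); pose proof (Hj j); split; lra).
    apply Rle_trans with (2 := HC j n m z Hn Hm Hzd).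
    apply Rmult_le_compat_r. apply Cmod_ge_0. apply Rle_Rpower_l. lra. nra. }
  assert (Hsmall : forall r e, 0 < e -> exists N, / (INR N + 1) / W r <= e).
  { intros r e He. pose proof (HW r) as Hr. destruct (INR_archimed (e * W r) 1) as [N HN]. nra.
    exists N. pose proof (Hj N). apply (Rmult_le_reg_l ((INR N + 1) * W r)). nra.
    replace ((INR N + 1) * W r * (/ (INR N + 1) / W r)) with 1 by (field; split; lra). nra. }
  assert (HD : forall r j n m z w, (j <= n)%nat -> (j <= m)%nat -> Cmod z <= r -> Cmod w <= r -> r < 1 ->
     Cmod ((G n w - G m w) - (G n z - G m z)) <= / (INR j + 1) / W r * Cmod (w - z)).
  { intros r j n m z w Hn Hm Hz Hw Hr.
    apply (Cmod_increment_le (fun w => G n w - G m w)%C (fun w => k n w - k m w)%C).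
    intros t Ht x. assert (Hx : Cmod x <= r) by (apply Cmod_segment_le; auto).
    split.
    - apply is_Cderive_minus; apply HG; unfold in_disc; lra.
    - apply HK; auto. }
  destruct (exists_choice (fun z p => in_disc z -> forall eps, 0 < eps -> exists N, forall n, (N <= n)%nat ->
     Cmod (k n z - p) <= eps)) as [kinf Hkinf].
  { intros z. destruct (classic (in_disc z)) as [Hz | Hz]; [|exists (RtoC 0); tauto].
    destruct (C_cauchy_limit (fun n => k n z)) as [p Hp].
    - intros e He. destruct (Hsmall (Cmod z) e He) as [N HN]. exists N. intros n m Hn Hm.
      apply Rle_trans with (2 := HN). apply HK; auto. lra.
    - exists p. auto. }
  destruct (exists_choice (fun z p => in_disc z -> forall eps, 0 < eps -> exists N, forall n, (N <= n)%nat ->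
     Cmod (G n z - p) <= eps)) as [g Hg].
  { intros z. destruct (classic (in_disc z)) as [Hz | Hz]; [|exists (RtoC 0); tauto].
    destruct (C_cauchy_limit (fun n => G n z)) as [p Hp].
    - intros e He. destruct (Hsmall (Cmod z) e He) as [N HN]. exists N. intros n m Hn Hm.
      unfold in_disc in Hz. pose proof (Cmod_ge_0 z).
      assert (Z : Cmod (RtoC 0) <= Cmod z) by (rewrite Cmod_0; auto).
      pose proof (HD (Cmod z) N n m (RtoC 0) z Hn Hm Z (Rle_refl _) Hz) as H1.
      rewrite !HG0 in H1.
      replace (G n z - G m z - (RtoC 0 - RtoC 0))%C with (G n z - G m z)%C in H1 by ring.
      replace (z - RtoC 0)%C with z in H1 by ring.
      assert (0 <= / (INR N + 1) / W (Cmod z)).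
      { apply Rdiv_le_0_compat; auto. apply Rlt_le, Rinv_0_lt_compat; auto. }
      nra.
    - exists p. auto. }
  assert (HkW : forall n z, in_disc z -> W (Cmod z) * Cmod (k n z - kinf z) <= / (INR n + 1)).
  { intros n z Hz. apply Rle_plus_epsilon. intros e He. pose proof (HW (Cmod z)) as Hw.
    destruct (Hkinf z Hz (e / W (Cmod z))) as [N HN]. { apply Rdiv_lt_0_compat; auto. }
    specialize (HN (max n N) ltac:(lia)).
    pose proof (HC n n (max n N) z ltac:(lia) ltac:(lia) Hz) as H1. fold (W (Cmod z)) in H1.
    replace (k n z - kinf z)%C with ((k n z - k (max n N) z) + (k (max n N) z - kinf z))%C by ring.
    pose proof (Cmod_triangle (k n z - k (max n N) z) (k (max n N) z - kinf z)) as H2.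
    apply (Rmult_le_compat_l (W (Cmod z))) in H2; [|lra].
    apply (Rmult_le_compat_l (W (Cmod z))) in HN; [|lra].
    replace (W (Cmod z) * (e / W (Cmod z))) with e in HN by (field; lra). lra. }
  (* The limit of [HD] as m grows: [G n - g] is Lipschitz with a small constant although [g] is not
     yet known to be differentiable. *)
  assert (HgD : forall r n z w, Cmod z <= r -> Cmod w <= r -> r < 1 ->
     Cmod ((G n w - g w) - (G n z - g z)) <= / (INR n + 1) / W r * Cmod (w - z)).
  { intros r n z w Hz Hw Hr. apply Rle_plus_epsilon. intros e He.
    destruct (Hg z ltac:(unfold in_disc; lra) (e / 2) ltac:(lra)) as [N1 HN1].
    destruct (Hg w ltac:(unfold in_disc; lra) (e / 2) ltac:(lra)) as [N2 HN2].
    set (m := max n (max N1 N2)).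
    specialize (HN1 m ltac:(lia)). specialize (HN2 m ltac:(lia)).
    pose proof (HD r n n m z w ltac:(lia) ltac:(lia) Hz Hw Hr) as H1.
    replace ((G n w - g w) - (G n z - g z))%C with
      (((G n w - G m w) - (G n z - G m z)) + ((G m w - g w) + - (G m z - g z)))%C by ring.
    pose proof (Cmod_triangle ((G n w - G m w) - (G n z - G m z)) ((G m w - g w) + - (G m z - g z))).
    pose proof (Cmod_triangle (G m w - g w) (- (G m z - g z))) as H2. rewrite Cmod_opp in H2. lra. }
  exists g, kinf. split; [|split]; auto.
  - apply Cmod_eq_0, Rle_antisym; [|apply Cmod_ge_0]. apply Rle_plus_epsilon. intros e He.
    destruct (Hg _ in_disc_0 e He) as [N HN]. specialize (HN N ltac:(lia)).
    rewrite HG0 in HN. replace (RtoC 0 - g (RtoC 0))%C with (- g (RtoC 0))%C in HN by ring.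
    rewrite Cmod_opp in HN. lra.
  - intros z Hz. apply is_Cderive_eps. intros e He. unfold in_disc in Hz.
    set (r := (1 + Cmod z) / 2). assert (Hr : r < 1) by (unfold r; lra).
    assert (Hzr : Cmod z <= r) by (unfold r; lra).
    destruct (Hsmall r (e / 3) ltac:(lra)) as [n Hn].
    pose proof (HG n z Hz) as HGn. apply is_Cderive_eps in HGn.
    destruct (HGn (e / 3) ltac:(lra)) as (d & Hd & Hlin).
    exists (Rmin d ((1 - Cmod z) / 2)). split. { apply Rmin_pos; lra. }
    intros w Hw.
    specialize (Hlin w (Rlt_le_trans _ _ _ Hw (Rmin_l _ _))).
    assert (Hw2 := Rlt_le_trans _ _ _ Hw (Rmin_r _ _)).
    assert (Hwr : Cmod w <= r).
    { replace w with ((w - z) + z)%C by ring. apply Rle_trans with (1 := Cmod_triangle _ _).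
      unfold r. lra. }
    pose proof (HgD r n z w Hzr Hwr Hr) as H1.
    assert (H2 : Cmod (k n z - kinf z) <= / (INR n + 1) / W r).
    { apply (Rmult_le_reg_l (W r)); auto.
      replace (W r * (/ (INR n + 1) / W r)) with (/ (INR n + 1))
        by (field; pose proof (HW r); pose proof (Hj n); split; lra).
      apply Rle_trans with (2 := HkW n z Hz).
      apply Rmult_le_compat_r. apply Cmod_ge_0. pose proof (Cmod_ge_0 z).
      apply Rle_Rpower_l. lra. nra. }
    (* Three terms of size e/3 |w - z|: the increment of [G n - g], the remainder of [G n] at [z],
       and the error in the derivative. *)
    replace (g w - g z - (w - z) * kinf z)%C with
      ((- ((G n w - g w) - (G n z - g z)) + (G n w - G n z - (w - z) * k n z)) + (w - z) * (k n z - kinf z))%C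
      by ring.
    apply Rle_trans with (1 := Cmod_triangle _ _). rewrite Cmod_mult.
    pose proof (Cmod_triangle (- ((G n w - g w) - (G n z - g z))) (G n w - G n z - (w - z) * k n z)) as H3.
    rewrite Cmod_opp in H3. pose proof (Cmod_ge_0 (w - z)) as H4.
    apply (Rmult_le_compat_r (Cmod (w - z)) _ _ H4) in Hn.
    apply (Rmult_le_compat_l (Cmod (w - z)) _ _ H4) in H2.
    lra.
Qed.

(** * Compactness *)

(** This is where the three cases are used. Always b = max(beta, 0). For alpha > 1 the growth
    exponent is gam = alpha - 1, leaving b < 1. For alpha <= 1 any small gam > 0 is admissible, and
    half the gap between alpha and b is taken. *)
Lemma bloch_exponents (alpha beta : R) : 0 < alpha ->
  (beta < alpha /\ alpha < 1) \/ (beta < 1 /\ 1 < alpha) \/ (beta < alpha /\ alpha = 1) ->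
  exists gam b, 0 < gam /\ 0 <= b /\ alpha <= gam + 1 /\ beta <= b /\ gam + b < alpha.
Proof.
  intros Ha H.
  pose proof (Rmax_l beta 0). pose proof (Rmax_r beta 0).
  assert (Hm : forall x, 0 < x -> beta < x -> Rmax beta 0 < x) by (intros; apply Rmax_lub_lt; auto).
  destruct H as [H | [H | H]].
  - pose proof (Hm alpha ltac:(lra) ltac:(lra)).
    exists ((alpha - Rmax beta 0) / 2), (Rmax beta 0). repeat split; lra.
  - pose proof (Hm 1 ltac:(lra) ltac:(lra)).
    exists (alpha - 1), (Rmax beta 0). repeat split; lra.
  - pose proof (Hm 1 ltac:(lra) ltac:(lra)).
    exists ((1 - Rmax beta 0) / 2), (Rmax beta 0). repeat split; lra.
Qed.

(** Total boundedness in place of normal families: closeness at finitely many net points extends to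
    the disc by the common Lipschitz constant [L], with error eta/3 for each of the two functions
    and eta/3 at the net point. *)
Lemma bloch_ball_almost_constant (alpha gam : R) (fs : nat -> C -> C) (r eta : R) (S : nat -> Prop) :
  0 < alpha -> 0 < gam -> alpha <= gam + 1 ->
  (forall n, in_Bloch0 alpha (fs n) /\ bloch_bound alpha (fs n) 1) ->
  0 < r < 1 -> 0 < eta -> unbounded S ->
  exists S', (forall n, S' n -> S n) /\ unbounded S' /\
    forall n m, S' n -> S' m -> forall w, Cmod w <= r -> Cmod (fs n w - fs m w) <= eta.
Proof.
  intros Ha Hg Hag Hfs Hr Heta HS.
  (* A net point close to [w] may fall outside radius [r]; d <= r' - r keeps it within r'. *)
  set (r' := (1 + r) / 2). assert (Hr' : r < r' < 1) by (unfold r'; lra).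
  set (L := Rpower (1 - r') (- (gam + 1))). assert (HL : 0 < L) by apply Rpower_pos.
  set (d := Rmin ((1 - r) / 2) (eta / (3 * L))).
  assert (Hd : 0 < d). { apply Rmin_pos. lra. apply Rdiv_lt_0_compat; lra. }
  assert (Hd1 : d <= (1 - r) / 2) by apply Rmin_l.
  assert (Hd2 : L * d <= eta / 3).
  { apply Rle_trans with (L * (eta / (3 * L))).
    - apply Rmult_le_compat_l. lra. apply Rmin_r.
    - right. field. lra. }
  destruct (finite_net d Hd) as [l Hl].
  assert (Hlip : forall n w p, Cmod w <= r' -> Cmod p <= r' -> Cmod (fs n w - fs n p) <= L * Cmod (w - p)).
  { intros n w p Hw Hp. destruct (Hfs n) as [[[Han _] _] Hb].
    apply (Cmod_increment_le (fs n) (C_derive (fs n))). intros t Ht x.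
    assert (Hx : Cmod x <= r') by (apply Cmod_segment_le; auto).
    assert (Hxd : in_disc x) by (unfold in_disc; lra).
    split. { apply is_Cderive_C_derive; auto. }
    apply Rle_trans with (1 := bloch_derive_le alpha gam Ha Hag (fs n) 1 x Han Hb Hxd).
    rewrite Rmult_1_l. unfold L. rewrite !Rpower_Ropp. apply Rinv_le_contravar. apply Rpower_pos.
    apply Rle_Rpower_l; lra. }
  destruct (pigeonhole_list fs (fun p => Cmod p <= r') (eta / 3) l ltac:(lra)) with (S := S)
    as (S' & H1 & H2 & H3); auto.
  { intros p Hp. exists (L * r'). intros n. destruct (Hfs n) as [[_ H0] _].
    assert (Z : Cmod (RtoC 0) <= r') by (rewrite Cmod_0; lra).
    pose proof (Hlip n p (RtoC 0) Hp Z) as H. rewrite H0 in H.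
    replace (fs n p - RtoC 0)%C with (fs n p) in H by ring.
    replace (p - RtoC 0)%C with p in H by ring.
    apply Rle_trans with (1 := H). apply Rmult_le_compat_l; lra. }
  exists S'. split; [|split]; auto. intros n m Hn Hm w Hw.
  destruct (Hl w ltac:(lra)) as (p & Hp & Hwp).
  assert (Hpr : Cmod p <= r').
  { replace p with (w + - (w - p))%C by ring. apply Rle_trans with (1 := Cmod_triangle _ _).
    rewrite Cmod_opp. unfold r'. lra. }
  pose proof (H3 n m p Hp Hpr Hn Hm) as H4.
  pose proof (Hlip n w p ltac:(lra) Hpr) as H5. pose proof (Hlip m w p ltac:(lra) Hpr) as H6.
  apply (Rmult_le_compat_l L) in Hwp; [|lra].
  replace (fs n w - fs m w)%C with (((fs n w - fs n p) + (fs n p - fs m p)) + - (fs m w - fs m p))%C by ring.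
  pose proof (Cmod_triangle ((fs n w - fs n p) + (fs n p - fs m p)) (- (fs m w - fs m p))) as T1.
  pose proof (Cmod_triangle (fs n w - fs n p) (fs n p - fs m p)) as T2.
  rewrite Cmod_opp in T1. lra.
Qed.

Theorem theorem3p4 (alpha beta : R) :
  0 < alpha ->
  ((beta < alpha /\ alpha < 1) \/ (beta < 1 /\ 1 < alpha) \/ (beta < alpha /\ alpha = 1)) ->
  (* C_beta maps B_alpha^0 into B_alpha^0 *)
  (forall f : C -> C, in_Bloch0 alpha f -> in_Bloch0 alpha (cesaro beta f)) /\
  (* C_beta is linear on B_alpha^0 *)
  (forall (f g : C -> C) (a : C), in_Bloch0 alpha f -> in_Bloch0 alpha g ->
     forall z : C, in_disc z ->
       cesaro beta (fun w => (a * f w + g w)%C) z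
       = (a * cesaro beta f z + cesaro beta g z)%C) /\
  (* C_beta is compact: the image of every sequence in the closed unit ball of
     B_alpha^0 has a subsequence converging in the B_alpha-norm to some g in B_alpha^0 *)
  (forall fs : nat -> C -> C,
     (forall n : nat, in_Bloch0 alpha (fs n) /\ bloch_bound alpha (fs n) 1) ->
     exists (phi : nat -> nat) (g : C -> C),
       (forall n : nat, (phi n < phi (S n))%nat) /\
       in_Bloch0 alpha g /\
       forall eps : R, 0 < eps -> exists N : nat, forall n : nat, (N <= n)%nat ->
         bloch_bound alpha (fun z => (cesaro beta (fs (phi n)) z - g z)%C) eps).
Proof.
  intros Ha Hcase.
  destruct (bloch_exponents alpha beta Ha Hcase) as (gam & b & Hg & Hb & Hab & Hbb & Hs).
  assert (Hmap : forall f : C -> C, in_Bloch0 alpha f -> in_Bloch0 alpha (cesaro beta f)).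
  { apply (cesaro_in_Bloch0 alpha beta gam b); auto. }
  split; [exact Hmap | split].
  { intros f g a [[Hf _] Hf0] [[Hg' _] Hg0] z Hz. apply cesaro_linear; auto. }
  intros fs Hfs.
  assert (Hh : forall n, exists h : C -> C,
    (forall w, in_disc w -> Ccont h w) /\
    (forall w, in_disc w -> w <> RtoC 0 -> h w = fs n w / (w * Cpow_pr (1 - w) beta))%C /\
    (forall z, in_disc z -> is_Cderive (cesaro beta (fs n)) z (h z)) /\
    cesaro beta (fs n) (RtoC 0) = RtoC 0).
  { intros n. destruct (Hfs n) as [[[Han _] H0] _].
    destruct (cesaro_derive beta (fs n) Han H0) as (h & h1 & h2 & h3 & _ & h4).
    exists h. auto. }
  destruct (exists_choice _ Hh) as [h Hh']. clear Hh.
  destruct (diagonal_extraction (fun j n m => forall z, in_disc z ->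
     Rpower (1 - Cmod z ^ 2) alpha * Cmod (h n z - h m z) <= / (INR j + 1))) as (phi & Hphi & HD).
  { intros j S0 HS0.
    assert (Hj : 0 < / (INR j + 1)) by (apply Rinv_0_lt_compat; pose proof (pos_INR j); lra).
    destruct (cesaro_small alpha beta gam b Ha Hg Hb Hab Hbb Hs _ Hj) as (r & eta & Hr & Heta & Hsm).
    destruct (bloch_ball_almost_constant alpha gam fs r eta S0 Ha Hg Hab Hfs Hr Heta HS0)
      as (S' & H1 & H2 & H3).
    exists S'. split; [|split]; auto. intros n m Hn Hm.
    destruct (Hfs n) as [[[Han _] Hn0] Hnb]. destruct (Hfs m) as [[[Ham _] Hm0] Hmb].
    destruct (Hh' n) as (n1 & n2 & n3 & _). destruct (Hh' m) as (m1 & m2 & m3 & _).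
    assert (Hder : forall w, in_disc w -> is_Cderive (fun w => fs n w - fs m w)%C w
       (C_derive (fs n) w - C_derive (fs m) w)%C).
    { intros w Hw. apply is_Cderive_minus; apply is_Cderive_C_derive; auto. }
    apply (Hsm (fun w => fs n w - fs m w)%C (fun w => h n w - h m w)%C
       (fun w => cesaro beta (fs n) w - cesaro beta (fs m) w)%C).
    - intros w Hw. eexists. apply Hder; auto.
    - rewrite Hn0, Hm0. ring.
    - intros z d Hz Hd. rewrite (is_Cderive_unique _ _ _ _ Hd (Hder z Hz)).
      pose proof (Hnb z _ Hz (is_Cderive_C_derive _ _ (Han z Hz))) as B1.
      pose proof (Hmb z _ Hz (is_Cderive_C_derive _ _ (Ham z Hz))) as B2.
      pose proof (Cmod_triangle (C_derive (fs n) z) (- C_derive (fs m) z)) as T. rewrite Cmod_opp in T.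
      apply (Rmult_le_compat_l (Rpower (1 - Cmod z ^ 2) alpha)) in T; [|apply Rlt_le, Rpower_pos].
      change (C_derive (fs n) z - C_derive (fs m) z)%C with (C_derive (fs n) z + - C_derive (fs m) z)%C.
      lra.
    - intros w Hw eps He.
      destruct (n1 w Hw (eps / 2) ltac:(lra)) as (e1 & He1 & E1).
      destruct (m1 w Hw (eps / 2) ltac:(lra)) as (e2 & He2 & E2).
      exists (Rmin e1 e2). split. { apply Rmin_pos; auto. }
      intros x Hx. specialize (E1 x (Rlt_le_trans _ _ _ Hx (Rmin_l _ _))).
      specialize (E2 x (Rlt_le_trans _ _ _ Hx (Rmin_r _ _))).
      replace (h n x - h m x - (h n w - h m w))%C with ((h n x - h n w) + - (h m x - h m w))%C by ring.
      apply Rle_lt_trans with (1 := Cmod_triangle _ _). rewrite Cmod_opp. lra.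
    - intros w Hw Hw0. rewrite n2, m2 by auto. unfold Cdiv. ring.
    - intros w Hw. apply is_Cderive_minus; auto.
    - intros w Hw. apply H3; auto. }
  destruct (weighted_limit alpha (fun n => cesaro beta (fs (phi n))) (fun n => h (phi n)) Ha)
    as (g & k & Hg0 & Hgd & Hk).
  { intros n. apply (Hh' (phi n)). }
  { intros n. apply (Hh' (phi n)). }
  { intros j n m z Hn Hm Hz. apply HD; auto. }
  exists phi, g. split; [exact Hphi | split].
  - split; [split|]; auto.
    + intros z Hz. eexists. apply Hgd; auto.
    (* In the weighted norm [k] is within 1 of [h (phi 0)], whose bound [M] comes from boundedness
       of the operator. *)
    + destruct (Hmap (fs (phi 0%nat)) (proj1 (Hfs _))) as [[_ [M HM]] _].
      exists (M + 1). intros z d Hz Hd. rewrite (is_Cderive_unique _ _ _ _ Hd (Hgd z Hz)).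
      pose proof (HM z _ Hz (proj1 (proj2 (proj2 (Hh' (phi 0%nat)))) z Hz)) as B1.
      pose proof (Hk 0%nat z Hz) as B2. simpl INR in B2. rewrite Rplus_0_l, Rinv_1 in B2.
      replace (k z) with (h (phi 0%nat) z + - (h (phi 0%nat) z - k z))%C by ring.
      pose proof (Cmod_triangle (h (phi 0%nat) z) (- (h (phi 0%nat) z - k z))) as T. rewrite Cmod_opp in T.
      apply (Rmult_le_compat_l (Rpower (1 - Cmod z ^ 2) alpha)) in T; [|apply Rlt_le, Rpower_pos].
      lra.
  - intros eps He. destruct (INR_archimed eps 1 He) as [N HN]. exists N. intros n Hn z d Hz Hd.
    pose proof (is_Cderive_minus _ _ z _ _ (proj1 (proj2 (proj2 (Hh' (phi n)))) z Hz) (Hgd z Hz)) as Hd'.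
    rewrite (is_Cderive_unique _ _ _ _ Hd Hd').
    apply Rle_trans with (1 := Hk n z Hz).
    apply le_INR in Hn. pose proof (pos_INR N).
    apply (Rmult_le_reg_l (INR n + 1)). lra. rewrite Rinv_r by lra. nra.
Qed.
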